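(* Assume the wavelets are compactly supported, let $s>0$, $p\in[1,+\infty)$ with $d-sp>0$, let $d'\in(d-sp,d)$ and let $(K,t,N,a,(\Theta_n),\mu)$ be adapted Cantor data of dimension at least $d'$. For every $\alpha\in(0,d-sp)$ and every $G\subset K$ with $\overline{\dim}_B(G)<\alpha$, there exists $f\in B^{s,1}_p(\mathbb R^d)$ with $\|f\|\le1$ such that: (1) for all $x\in K$ and all $j\in\mathbb N$, $P_jf(x)\ge0$; (2) for all $x\in G$, $\liminf_j\frac{\log|P_jf(x)|}{j\log2}\ge\frac{d-sp-\alpha}p$.
   Context: Standing setup. $(V_j)_{j\in\mathbb Z}$ is an orthogonal multiresolution analysis of $L^2(\mathbb R^d)$ with scaling function $\varphi$, and $\psi^{(1)},\dots,\psi^{(2^d-1)}$ associated wavelets (the functions $2^{dj/2}\psi^{(i)}(2^j\cdot-k)$ form an orthonormal basis of $L^2(\mathbb R^d)$), smooth (at least $\lfloor s\rfloor+1$ derivatives). For $j\ge0$, $k\in\mathbb Z^d$, the dyadic cube $(j,k)=\prod_m[k_m2^{-j},(k_m+1)2^{-j})$, $\Lambda_j$ the set of such cubes, $\psi^{(i)}_{(j,k)}(x)=\psi^{(i)}(2^jx-k)$; for a closed dyadic cube $\mu=\prod_m[k_m2^{-j},(k_m+1)2^{-j}]$ write $\psi^{(1)}_\mu=\psi^{(1)}(2^j\cdot-k)$. For $f$: $C_k=\int\overline{\varphi(x-k)}f$, $c^{(i)}_\lambda=2^{dj}\int\overline{\psi^{(i)}_\lambda}f$, $Q_lf=\sum_i\sum_{\lambda\in\Lambda_l}c^{(i)}_\lambda\psi^{(i)}_\lambda$,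 $P_jf=\sum_kC_k\varphi(\cdot-k)+\sum_{0\le l<j}Q_lf$. $B^{s,q}_p(\mathbb R^d)$: $f$ with $(C_k)\in\ell^p$ and $(\varepsilon_j)\in\ell^q$, $\varepsilon_j=2^{(s-d/p)j}(\sum_i\sum_{\lambda\in\Lambda_j}|c^{(i)}_\lambda|^p)^{1/p}$, norm $\|(C_k)\|_{\ell^p}+\|(\varepsilon_j)\|_{\ell^q}$. $\overline{\dim}_B$ is upper box dimension; $\log0=-\infty$. Adapted Cantor data of dimension at least $d'$: a compact self-similar set $K\subset\mathbb R^d$ satisfying the open set condition with $\dim_{\mathcal H}K=\dim_{\mathcal P}K\ge d'$, integers $t,N\ge1$, a nonzero real $a$, finite families $\Theta_n$ ($n\ge0$) of closed dyadic cubes of side $2^{-(t+Nn)}$ and injective maps $\mu$ from $\Theta_n$ to closed dyadic cubes of side $2^{-Nn}$, such that $K_n=\bigcup_{\lambda\in\Theta_n}\lambda$ is decreasing, $K=\bigcap_nK_n$, and for all $n$, $x\in K_n$, $\lambda\in\Theta_n$: $a\psi^{(1)}_{\mu(\lambda)}(x)\ge1$ if $x\in\lambda$ and $\psi^{(1)}_{\mu(\lambda)}(x)=0$ otherwise. (Such data exist for every $d'\in(0,d)$ when the wavelets are compactly supported.) *)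

(* Defs.v *)
From HB Require Import structures.
From mathcomp Require Import all_boot all_order all_algebra.
From mathcomp Require Import all_classical all_reals all_analysis.
From mathcomp Require Import complex.
Import Order.TTheory GRing.Theory Num.Theory.
Import numFieldNormedType.Exports.

Set Implicit Arguments.
Unset Strict Implicit.
Unset Printing Implicit Defensive.

Local Open Scope ring_scope.
Local Open Scope classical_set_scope.

Section WaveletDefs.
Context {R : realType} {d : nat}.

Local Notation P := 'rV[R]_d.
Local Notation Zd := 'rV[int]_d.
Local Notation C := R[i].

Definition cabs (z : C) : R := ComplexField.Normc.normc z.

Definition rc (r : R) : C := Complex r 0.

Definition zpt (k : Zd) : P := map_mx (fun z : int => z%:~R) k.

Definition edist (x y : P) : R := Num.sqrt (\sum_(i < d) (x 0 i - y 0 i) ^+ 2).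

Definition borel_fun (g : P -> R) : Prop :=
  forall B : set R, open B -> <<s (@open P) >> (g @^-1` B).

Definition cmeasurable (f : P -> C) : Prop :=
  borel_fun (fun x => complex.Re (f x)) /\ borel_fun (fun x => complex.Im (f x)).

(* Iterated Lebesgue integral of a nonnegative function on R^n
   (= the Lebesgue integral on R^n for Borel functions, by Tonelli). *)
Fixpoint iint (n : nat) : ('rV[R]_n -> \bar R) -> \bar R :=
  match n with
  | 0 => fun g => g 0
  | n'.+1 => fun g =>
      (\int[@lebesgue_measure R]_x iint (fun y => g (row_mx (const_mx x : 'rV_1) y)))%E
  end.

Definition pint (g : P -> \bar R) : \bar R := @iint d g.

(* Lebesgue integral of a real / complex function (meaningful when integrable) *)
Definition rint (h : P -> R) : R :=
  fine (pint (fun x => (Num.max (h x) 0)%:E)) - fine (pint (fun x => (Num.max (- h x) 0)%:E)).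

Definition cint (g : P -> C) : C :=
  Complex (rint (fun x => complex.Re (g x))) (rint (fun x => complex.Im (g x))).

Definition sqnorm (f : P -> C) : \bar R := pint (fun x => ((cabs (f x)) ^+ 2)%:E).
Definition sqdist (f g : P -> C) : \bar R := sqnorm (fun x => f x - g x).

Definition L2 (f : P -> C) : Prop := cmeasurable f /\ (sqnorm f < +oo)%E.

Definition inner (f g : P -> C) : C := cint (fun x => f x * conjc (g x)).

Definition closed_subspace (V : set (P -> C)) : Prop :=
  V `<=` L2 /\ V (fun _ => 0) /\
  (forall (c : C) f g, V f -> V g -> V (fun x => c * f x + g x)) /\
  (forall (u : nat -> P -> C) f, (forall n, V (u n)) -> L2 f ->
     (fun n => sqdist (u n) f) @ \oo --> 0%E -> V f).

Definition orthonormal (I : eqType) (e : I -> P -> C) : Prop :=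
  (forall i, L2 (e i)) /\ (forall i j, inner (e i) (e j) = (i == j)%:R).

Definition ONB_of (V : set (P -> C)) (I : eqType) (e : I -> P -> C) : Prop :=
  orthonormal e /\ (forall i, V (e i)) /\
  (forall f, V f -> (forall i, inner f (e i) = 0) -> sqnorm f = 0%E).

Definition dilz (j : int) (k : Zd) (x : P) : P := ((2 : R) ^ j) *: x - zpt k.
Definition diln (j : nat) (k : Zd) (x : P) : P := ((2 : R) ^+ j) *: x - zpt k.

Definition MRA (V : int -> set (P -> C)) (phi : P -> C) : Prop :=
  (forall j, closed_subspace (V j)) /\
  (forall j, V j `<=` V (j + 1)) /\
  (forall j f, V j f <-> V (j + 1) (fun x => f ((2 : R) *: x))) /\
  (forall f, (forall j, V j f) -> sqnorm f = 0%E) /\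
  (forall f, L2 f -> forall eps : R, 0 < eps ->
     exists j g, V j g /\ (sqdist f g < eps%:E)%E) /\
  ONB_of (V 0) (fun k : Zd => fun x => phi (x - zpt k)).

Definition associated_wavelets (V : int -> set (P -> C))
    (psi : 'I_(2 ^ d - 1) -> P -> C) : Prop :=
  (forall i (k : Zd), V 1 (fun x => psi i (x - zpt k)) /\
     (forall g, V 0 g -> inner (fun x => psi i (x - zpt k)) g = 0)) /\
  ONB_of L2 (fun t : 'I_(2 ^ d - 1) * int * Zd =>
    fun x => rc ((2 : R) `^ ((d%:R * t.1.2%:~R) / 2)) * psi t.1.1 (dilz t.1.2 t.2 x)).

Definition compact_support (g : P -> C) : Prop :=
  exists M : R, forall x, M < edist x 0 -> g x = 0.

Definition partial (i : 'I_d) (g : P -> R) (x : P) : R :=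
  derive1 (fun t : R => g (x + t *: delta_mx 0 i)) 0.

Fixpoint Cr (r : nat) (g : P -> R) : Prop :=
  continuous g /\
  match r with
  | 0 => True
  | r'.+1 => forall i : 'I_d,
      (forall x, derivable (fun t : R => g (x + t *: delta_mx 0 i)) 0 1) /\
      Cr r' (partial i g)
  end.

Definition smooth_of_order (r : nat) (g : P -> C) : Prop :=
  Cr r (fun x => complex.Re (g x)) /\ Cr r (fun x => complex.Im (g x)).

Definition Ccoef (phi : P -> C) (f : P -> C) (k : Zd) : C :=
  cint (fun x => conjc (phi (x - zpt k)) * f x).

Definition ccoef (psi : 'I_(2 ^ d - 1) -> P -> C) (f : P -> C)
    (i : 'I_(2 ^ d - 1)) (j : nat) (k : Zd) : C :=
  rc ((2 : R) ^+ (d * j)) * cint (fun x => conjc (psi i (diln j k x)) * f x).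

Definition lp_norm (p : R) (c : Zd -> C) : \bar R :=
  poweR (\esum_(k in [set: Zd]) ((cabs (c k)) `^ p)%:E) (p^-1).

Definition eps_j (s p : R) (psi : 'I_(2 ^ d - 1) -> P -> C) (f : P -> C) (j : nat) : \bar R :=
  (((2 : R) `^ ((s - d%:R / p) * j%:R))%:E *
   poweR (\esum_(t in [set: 'I_(2 ^ d - 1) * Zd])
            ((cabs (ccoef psi f t.1 j t.2)) `^ p)%:E) (p^-1))%E.

Definition besov_norm (s p : R) phi psi (f : P -> C) : \bar R :=
  (lp_norm p (Ccoef phi f) + \sum_(j <oo) eps_j s p psi f j)%E.

Definition locally_integrable (f : P -> C) : Prop :=
  cmeasurable f /\
  forall M : R, (pint (fun x => (if edist x 0 <= M then cabs (f x) else 0)%:E) < +oo)%E.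

Definition in_besov_s1p (s p : R) phi psi (f : P -> C) : Prop :=
  locally_integrable f /\ (besov_norm s p phi psi f < +oo)%E.

Definition boxsum (F : Zd -> C) (n : nat) : C :=
  \sum_(t : 'rV['I_(2 * n).+1]_d) F (map_mx (fun i : 'I_(2 * n).+1 => (i : nat)%:Z - n%:Z) t).

Definition zsum (F : Zd -> C) : C :=
  Complex (limn (fun n => complex.Re (boxsum F n))) (limn (fun n => complex.Im (boxsum F n))).

Definition Pj phi psi (f : P -> C) (j : nat) (x : P) : C :=
  zsum (fun k => Ccoef phi f k * phi (x - zpt k)) +
  \sum_(l < j) \sum_(i < 2 ^ d - 1)
     zsum (fun k => ccoef psi f i l k * psi i (diln l k x)).

Definition diam (A : set P) : \bar R :=
  ereal_sup [set (edist x y)%:E | x in A & y in A].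

Definition Hdelta (s delta : R) (E : set P) : \bar R :=
  ereal_inf [set (\sum_(i <oo) ((fine (diam (U i))) `^ s)%:E)%E |
    U in [set U : nat -> set P | E `<=` \bigcup_i U i /\
                                 forall i, (diam (U i) <= delta%:E)%E]].

Definition Hmeasure (s : R) (E : set P) : \bar R :=
  ereal_sup [set Hdelta s delta E | delta in [set delta : R | 0 < delta]].

Definition dimH (E : set P) : \bar R :=
  ereal_inf [set s%:E | s in [set s : R | 0 < s /\ Hmeasure s E = 0%E]].

Definition cball (c : P) (r : R) : set P := [set y | edist c y <= r].

Definition Pdelta (s delta : R) (E : set P) : \bar R :=
  ereal_sup [set v | exists (n : nat) (c : 'I_n -> P) (r : 'I_n -> R),
    (forall i, E (c i) /\ 0 < r i <= delta) /\
    (forall i j, i != j -> cball (c i) (r i) `&` cball (c j) (r j) = set0) /\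
    v = (\sum_(i < n) ((2 * r i) `^ s)%:E)%E].

Definition Pzero (s : R) (E : set P) : \bar R :=
  ereal_inf [set Pdelta s delta E | delta in [set delta : R | 0 < delta]].

Definition Pmeasure (s : R) (E : set P) : \bar R :=
  ereal_inf [set (\sum_(i <oo) Pzero s (F i))%E |
    F in [set F : nat -> set P | E `<=` \bigcup_i F i]].

Definition dimP (E : set P) : \bar R :=
  ereal_inf [set s%:E | s in [set s : R | 0 < s /\ Pmeasure s E = 0%E]].

Definition elog (x : \bar R) : \bar R :=
  match x with
  | EFin r => if r == 0 then -oo%E else (ln r)%:E
  | +oo%E => +oo%E
  | -oo%E => -oo%E
  end.

Definition Ncov (delta : R) (E : set P) : \bar R :=
  ereal_inf [set (n%:R)%:E | n in [set n : nat | exists U : 'I_n -> set P,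
     E `<=` \bigcup_i U i /\ forall i, (diam (U i) <= delta%:E)%E]].

Definition upper_box_dim (E : set P) : \bar R :=
  ereal_inf [set ereal_sup [set (elog (Ncov delta E) * ((- ln delta)^-1)%:E)%E |
                            delta in [set delta : R | 0 < delta < eps]] |
             eps in [set eps : R | 0 < eps < 1]].

Definition similarity (S : P -> P) (r : R) : Prop :=
  forall x y, edist (S x) (S y) = r * edist x y.

Definition self_similar_OSC (K : set P) : Prop :=
  exists (m : nat) (S : 'I_m -> P -> P) (r : 'I_m -> R),
    (0 < m)%N /\ (forall i, 0 < r i < 1 /\ similarity (S i) (r i)) /\
    K !=set0 /\ compact K /\ K = \bigcup_(i in [set: 'I_m]) (S i @` K) /\
    exists U : set P, open U /\ U !=set0 /\ (forall i, S i @` U `<=` U) /\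
      (forall i j, i != j -> S i @` U `&` S j @` U = set0).

Definition cube (j : nat) (k : Zd) : set P :=
  [set x | forall i : 'I_d,
     (k 0 i)%:~R / (2 : R) ^+ j <= x 0 i <= ((k 0 i)%:~R + 1) / (2 : R) ^+ j].

Definition Kn (t N : nat) (Theta : nat -> set Zd) (n : nat) : set P :=
  \bigcup_(lam in Theta n) cube (t + N * n) lam.

(* (K, t, N, a, Theta, mu) is adapted Cantor data of dimension at least d'
   relative to the wavelet psi1 = psi^(1); cubes are represented by their
   integer index k (level given by the family). *)
Definition adapted_cantor_data (psi1 : P -> C) (d' : R) (K : set P) (t N : nat)
    (a : R) (Theta : nat -> set Zd) (mu : nat -> Zd -> Zd) : Prop :=
  self_similar_OSC K /\ dimH K = dimP K /\ (d'%:E <= dimH K)%E /\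
  (1 <= t)%N /\ (1 <= N)%N /\ a != 0 /\
  (forall n, finite_set (Theta n)) /\
  (forall n lam lam', Theta n lam -> Theta n lam' -> mu n lam = mu n lam' -> lam = lam') /\
  (forall n, Kn t N Theta n.+1 `<=` Kn t N Theta n) /\
  K = \bigcap_n Kn t N Theta n /\
  (forall n x lam, Kn t N Theta n x -> Theta n lam ->
     (cube (t + N * n) lam x -> 1 <= rc a * psi1 (diln (N * n) (mu n lam) x)) /\
     (~ cube (t + N * n) lam x -> psi1 (diln (N * n) (mu n lam) x) = 0)).

End WaveletDefs.

(* Main.v *)
(** Let [beta = (d - s p - alpha) / p] and let [S_l], for [l = N n], be the set
    of the [mu(lam)] with [lam] in [Theta_n] meeting [G]. The function
    [f = sum_l c a 2^(beta l) sum_(k in S_l) psi1(2^l . - k)] works. Since the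
    upper box dimension of [G] is below some [alpha' < alpha], [#S_l] is
    [O(2^(alpha' l))], which makes the Besov norm a convergent geometric series
    of ratio [2^(-(alpha - alpha')/p)]. On [K] all terms of [P_j f] are
    nonnegative, and at a point of [G] some term of level [N n] is at least
    [c 2^(beta N n)], for every large [n].

    As the coefficients grow with [l], the series converges only in [L^1]:
    its [L^1] norm is at most a constant times
    [sum_l 2^((beta + alpha' - d) l)], which is finite because
    [beta <= d - s p - alpha] when [p >= 1]. Dominated convergence then reads
    off the wavelet coefficients of [f] from the orthonormality relations. *)

Require Import Defs.
From HB Require Import structures.
From mathcomp Require Import all_boot all_order all_algebra.
From mathcomp Require Import all_classical all_reals all_analysis.
From mathcomp Require Import measurable_realfun complex.
From mathcomp Require Import ring lra zify.
Import Order.TTheory GRing.Theory Num.Theory.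
Import numFieldNormedType.Exports.
Local Open Scope ring_scope.
Local Open Scope classical_set_scope.

Set Implicit Arguments.
Unset Strict Implicit.
Unset Printing Implicit Defensive.

(** * Borel sets of row vectors and the iterated integral *)

Notation borelRow R n := (g_sigma_algebraType (@open 'rV[R]_n)).

Section SigmaFinitePack.
Context d (T : measurableType d) {R : realType} (mu : {measure set T -> \bar R}).
Hypothesis smu : sigma_finite setT mu.

Let nu : set T -> \bar R := mu.

HB.instance Definition _ := Measure.on nu.
HB.instance Definition _ := Measure_isSigmaFinite.Build _ _ _ nu smu.

(** Tonelli's theorem takes a bundled sigma-finite measure, while sigma-finiteness is obtained below
    as a mere proposition, by induction on the dimension. This passes from one form to the other. *)
Lemma sigma_finite_measure_pack :
  exists m : {sigma_finite_measure set T -> \bar R}, m = mu :> (set T -> \bar R).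
Proof. by exists nu. Qed.

End SigmaFinitePack.

Section BorelRow.
Context {R : realType}.

(** An open set of row vectors is a countable union of balls with rational
    center and radius. *)
Lemma measurable_fun_row d (X : measurableType d) n (F : X -> 'rV[R]_n) :
  (forall i, measurable_fun [set: X] (fun x => F x 0 i : R)) ->
  measurable_fun [set: X] (F : X -> borelRow R n).
Proof.
move=> mF.
have bE (q : 'rV[R]_n) (e : R) : measurable (F @^-1` ball q e).
  case: (ltP 0 e) => e0; last first.
    rewrite (_ : F @^-1` _ = set0) //; apply/seteqP; split => // x.
    by case=> /= /lt_geF; rewrite e0.
  rewrite (_ : F @^-1` _ =
    \bigcap_(i in [set: 'I_n]) ((fun x => F x 0 i) @^-1` ball (q 0 i) e)).
    apply: fin_bigcap_measurable => [|i _]; first by have := @finite_finset (ordinal n); apply.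
    rewrite -[_ @^-1` _]setTI; apply: mF => //.
    exact: measurable_realfun.measurable_ball.
  apply/seteqP; split => x /=; first by case=> _ h i _; exact: h.
  by move=> h; split => // i j; rewrite ord1; exact: h.
apply: (@measurability _ _ X (borelRow R n) setT F (@open 'rV[R]_n)) => //.
move=> _ [A oA <-]; rewrite setTI.
pose B (t : 'rV[rat]_n * rat) : set X :=
  if `[< ball (map_mx ratr t.1 : 'rV[R]_n) (ratr t.2 : R) `<=` A >]
  then F @^-1` ball (map_mx ratr t.1 : 'rV[R]_n) (ratr t.2 : R) else set0.
have -> : F @^-1` A = \bigcup_t B t.
  apply/seteqP; split => x /=; last first.
    by case=> t _; rewrite /B; case: asboolP => // h; exact: h.
  move=> Ax; have /nbhs_ballP[e /= e0 eA] : nbhs (F x) A by exact: open_nbhs_nbhs.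
  have [r /[!in_itv]/= /andP[r0 re]] : exists q : rat, ratr q \in `]0, e / 2[%R.
    by apply: rat_in_itvoo; rewrite divr_gt0.
  have /choice[q qP] : forall i, exists q : rat, ratr q \in `](F x 0 i - ratr r), (F x 0 i)[%R.
    by move=> i; apply: rat_in_itvoo; rewrite ltrBlDr ltrDl.
  exists (\row_i q i, r) => //; rewrite /B; case: asboolP => /=; last first.
    case=> y [_ /= h]; apply: eA; split => // i j; rewrite ord1.
    have := h 0 j; rewrite !mxE /ball /= => h1.
    have := qP j; rewrite in_itv /= => /andP[q1 q2].
    move: h1 re; rewrite !ltr_norml => /andP[? ?] ?.
    by apply/andP; split; lra.
  move=> _; split => // i j; rewrite ord1 !mxE /ball /=.
  have := qP j; rewrite in_itv /= => /andP[q1 q2].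
  by rewrite ltr_norml; apply/andP; split; lra.
apply: countable_bigcupT_measurable => //.
by move=> t; rewrite /B; case: ifP => _ //; exact: bE.
Qed.

Lemma borel_funE n (g : 'rV[R]_n -> R) :
  borel_fun g <-> measurable_fun [set: borelRow R n] (g : borelRow R n -> R).
Proof.
split=> mg.
  apply: (measurability _ (measurable_realfun.RGenOpens.measurableE R)).
  move=> _ [_ [a [b ->] <-]]; rewrite setTI; apply: mg; exact: interval_open.
move=> B oB; rewrite -[_ @^-1` _]setTI; apply: mg => //.
exact: measurable_realfun.open_measurable.
Qed.

Lemma continuous_measurable_row n (g : 'rV[R]_n -> R) : continuous g ->
  measurable_fun [set: borelRow R n] (g : borelRow R n -> R).
Proof.
move=> /continuousP cg; apply/borel_funE => B oB.
by apply: sub_sigma_algebra; apply: cg.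
Qed.

Lemma measurable_coord n (i : 'I_n) :
  measurable_fun [set: borelRow R n] (fun x : borelRow R n => (x : 'rV[R]_n) 0 i : R).
Proof. by apply: continuous_measurable_row; exact: coord_continuous. Qed.

Lemma measurable_row_mx n : measurable_fun [set: R * borelRow R n]
  (fun z : R * borelRow R n =>
     row_mx (const_mx z.1 : 'rV_1) (z.2 : 'rV[R]_n) : borelRow R (1 + n)).
Proof.
apply: measurable_fun_row => i.
case: (splitP i) => j ij.
  rewrite (_ : (fun _ => _) = fst) //; apply/funext => z.
  by rewrite (_ : i = lshift n j) ?row_mxEl ?mxE//; exact: val_inj.
rewrite (_ : (fun _ => _) = (fun x : borelRow R n => (x : 'rV[R]_n) 0 j : R) \o snd).
  by apply: measurableT_comp => //; exact: measurable_coord.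
apply/funext => z /=.
by rewrite (_ : i = rshift 1 j) ?row_mxEr//; exact: val_inj.
Qed.

(** Induction on the dimension: the next measure is the image under [row_mx] of the product of
    Lebesgue measure with the previous one, and Tonelli identifies its integral with the iterated
    one. Sigma-finiteness is carried along because Tonelli needs it at the next stage. Afterwards
    [pint] can be treated as an integral against a measure. *)
Lemma exists_measure_iint n : exists mu : {measure set (borelRow R n) -> \bar R},
  sigma_finite setT mu /\
  forall g : 'rV[R]_n -> \bar R, (forall x, 0 <= g x)%E ->
    measurable_fun [set: borelRow R n] (g : borelRow R n -> \bar R) ->
    iint g = (\int[mu]_x g x)%E.
Proof.
elim: n => [|n [mu [smu IH]]].
  exists (\d_(0 : borelRow R 0) : {measure set (borelRow R 0) -> \bar R}); split.
    exists (fun=> setT) => [|i]; first by rewrite bigcup_const.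
    by split; rewrite //= diracT ltry.
  by move=> g g0 mg /=; rewrite integral_dirac// diracT mul1e.
have [smu' muE] := sigma_finite_measure_pack smu.
pose e (z : measurableTypeR R * borelRow R n) : borelRow R (1 + n) :=
  row_mx (const_mx z.1 : 'rV_1) (z.2 : 'rV[R]_n).
have me : measurable_fun setT e by exact: measurable_row_mx.
pose m : {measure set (measurableTypeR R * borelRow R n) -> \bar R} :=
  ((@lebesgue_measure R) \x smu')%E.
pose nu : {measure set (borelRow R (1 + n)) -> \bar R} :=
  measure_function_pushforward__canonical__measure_function_Measure m me.
(* A measurable left inverse of [e]: pulling back along it transports an exhaustion of the product
   to row vectors. *)
pose e' (x : borelRow R (1 + n)) : measurableTypeR R * borelRow R n :=
  ((x : 'rV[R]_(1 + n)) 0 (lshift n 0), rsubmx (x : 'rV[R]_(1 + n))).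
have me' : measurable_fun setT e'.
  apply: measurable_fun_pair; first exact: measurable_coord.
  apply: measurable_fun_row => i; under eq_fun do rewrite mxE.
  exact: measurable_coord.
have ee' z : e' (e z) = z.
  case: z => u v; rewrite /e /e' row_mxKr; congr pair.
  by rewrite row_mxEl mxE.
exists nu; split.
  have [F UF mF] : sigma_finite setT m.
    have /sigma_finiteP[F [UF ndF Foo]] := sigma_finiteT (@lebesgue_measure R).
    have /sigma_finiteP[G [UG ndG Goo]] := sigma_finiteT smu'.
    (* Both exhaustions are nondecreasing, so the diagonal products already cover the whole
       space. *)
    exists (fun k => F k `*` G k) => [|k].
      rewrite -setXTT UF UG; apply/seteqP; split => -[x y] /=.
        move=> [[i _ Fx] [j _ Gy]]; exists (maxn i j) => //; split.
          by move: x Fx; exact/subsetPset/ndF/leq_maxl.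
        by move: y Gy; exact/subsetPset/ndG/leq_maxr.
      by move=> [k _ [? ?]]; split; exists k.
    have [? ?] := Foo k; have [? ?] := Goo k.
    split; first exact: measurableX.
    by rewrite /m /= product_measure1E// lte_mul_pinfty// ge0_fin_numE.
  exists (fun i => e' @^-1` F i); first by rewrite -preimage_bigcup -UF.
  move=> i; have [mFi Foo] := mF i; split.
    by rewrite -[_ @^-1` _]setTI; exact: me'.
  rewrite /nu /= /pushforward -comp_preimage (_ : e' \o e = id)//.
  exact/funext.
move=> g g0 mg.
rewrite (_ : (\int[nu]_x g x = \int[pushforward m e]_(x in setT) g x)%E)//.
rewrite ge0_integral_pushforward//= preimage_setT.
rewrite fubini_tonelli1//; last exact: measurableT_comp.
apply: eq_integral => x _; rewrite IH// -?muE//.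
exact: (measurableT_comp mg (measurableT_comp me (pair1_measurable x))).
Qed.
End BorelRow.

(** * Affine change of variables *)

Section AffineChangeOfVariables.
Context {R : realType}.

(** The image of Lebesgue measure under [x -> c x + v], multiplied by [c], gives each interval []a,
    b]] its length, hence is Lebesgue measure by uniqueness. *)
Lemma ge0_integral_affine (c v : R) (h : measurableTypeR R -> \bar R) :
  0 < c -> measurable_fun setT h -> (forall x, (0 <= h x)%E) ->
  (\int[@lebesgue_measure R]_x h (c * x + v)%R =
   (c^-1)%:E * \int[@lebesgue_measure R]_x h x)%E.
Proof.
move=> c0 mh h0.
pose phi (x : measurableTypeR R) : measurableTypeR R := c * x + v.
have mphi : measurable_fun setT phi.
  by apply: measurable_funD => //; exact: measurable_funM.
have c0' : 0 <= c by exact: ltW.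
pose m : {measure set (measurableTypeR R) -> \bar R} :=
  measure_function_pushforward__canonical__measure_function_Measure
    (@lebesgue_measure R) mphi.
have mE : forall A, measurable A -> (@lebesgue_measure R) A = mscale (NngNum c0') m A.
  apply: lebesgue_measure_unique => _ [[a b]] _ <-.
  transitivity (c%:E * (@lebesgue_measure R) (phi @^-1` `]a, b]%classic))%E; last by [].
  rewrite (_ : phi @^-1` _ = `](a - v) / c, (b - v) / c]%classic); last first.
    apply/seteqP; split => x /=; rewrite /phi !in_itv /= => /andP[h1 h2]; apply/andP;
      move: h1 h2; rewrite ltr_pdivrMr// ler_pdivlMr// ltrBlDr lerBrDr mulrC; split => //;
      by rewrite mulrC.
  rewrite !lebesgue_measure_itv /= !lte_fin ltr_pM2r ?invr_gt0// ltrD2r.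
  case: ifPn => _; last by rewrite mule0.
  by rewrite -EFinD -EFinM; congr EFin; field; rewrite gt_eqF.
have -> : (\int[@lebesgue_measure R]_x h x = c%:E * \int[@lebesgue_measure R]_x h (phi x))%E.
  transitivity (\int[mscale (NngNum c0') m]_x h x)%E.
    by apply: eq_measure_integral => A mA _; exact: mE.
  rewrite ge0_integral_mscale//=; congr (_ * _)%E.
  by rewrite (ge0_integral_pushforward mphi)// preimage_setT.
by rewrite muleA -EFinM mulVf ?mul1e// gt_eqF.
Qed.

(** The inner iterated integral is a section integral of a measurable function on a product, so
    Tonelli gives its measurability in the outer variable. *)
Lemma measurable_iint_row_mx n (g : 'rV[R]_(1 + n) -> \bar R) :
  (forall x, (0 <= g x)%E) ->
  measurable_fun [set: borelRow R (1 + n)] (g : borelRow R (1 + n) -> \bar R) ->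
  measurable_fun [set: measurableTypeR R]
    (fun x : measurableTypeR R => iint (fun y : 'rV[R]_n => g (row_mx (const_mx x : 'rV_1) y))).
Proof.
move=> g0 mg.
have [mu [smu muE]] := @exists_measure_iint R n.
have [m mE] := sigma_finite_measure_pack smu.
pose G (z : measurableTypeR R * borelRow R n) : \bar R :=
  g (row_mx (const_mx z.1 : 'rV_1) (z.2 : 'rV[R]_n)).
have mG : measurable_fun setT G by exact: (measurableT_comp mg (@measurable_row_mx R n)).
rewrite (_ : (fun _ => _) = fubini_F m G).
  by apply: measurable_fun_fubini_tonelli_F => // z; exact: g0.
apply/funext => x; rewrite muE -?mE//.
exact: (measurableT_comp mG (pair1_measurable x)).
Qed.

Lemma iint_ge0 n (g : 'rV[R]_n -> \bar R) : (forall x, 0 <= g x)%E -> (0 <= iint g)%E.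
Proof. by elim: n g => [|n IH] g g0 //=; apply: integral_ge0 => x _; exact: IH. Qed.

Lemma measurable_affine n (c : R) (v : 'rV[R]_n) :
  measurable_fun [set: borelRow R n] (fun x => c *: (x : 'rV[R]_n) + v : borelRow R n).
Proof.
apply: measurable_fun_row => i; under eq_fun do rewrite !mxE.
apply: measurable_funD => //; apply: measurable_funM => //.
exact: measurable_coord.
Qed.

(** Each coordinate contributes one factor [c^-1]: the induction hypothesis rescales the inner
    coordinates, the one-dimensional formula the outer one. *)
Lemma iint_affine n (c : R) (v : 'rV[R]_n) (g : 'rV[R]_n -> \bar R) :
  0 < c -> (forall x, 0 <= g x)%E ->
  measurable_fun [set: borelRow R n] (g : borelRow R n -> \bar R) ->
  (iint (fun x => g (c *: x + v)%R) = (c^-1 ^+ n)%:E * iint g)%E.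
Proof.
move=> c0; elim: n v g => [|n IH] v g g0 mg.
  by rewrite /= mul1e; congr g; apply/rowP => -[].
move: v g g0 mg; rewrite -[n.+1]/(1 + n)%N => v g g0 mg /=.
pose v0 := v 0 (lshift n 0).
pose G x := iint (fun y : 'rV[R]_n => g (row_mx (const_mx x : 'rV_1) y)).
transitivity (\int[@lebesgue_measure R]_x ((c^-1 ^+ n)%:E * G (c * x + v0)%R))%E.
  apply: eq_integral => x _.
  rewrite -(IH (rsubmx v)); last 2 first.
  - by move=> y.
  - exact: (measurableT_comp mg (measurableT_comp (@measurable_row_mx R n) (pair1_measurable _))).
  congr iint; apply/funext => y; congr g.
  rewrite scale_row_mx -{1}(hsubmxK v) add_row_mx; congr row_mx.
  by apply/rowP => j; rewrite !mxE ord1.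
rewrite ge0_integralZl//; last 3 first.
- have maff : measurable_fun [set: measurableTypeR R]
      (fun x : measurableTypeR R => c * x + v0 : measurableTypeR R).
    by apply: measurable_funD => //; exact: measurable_funM.
  exact: (measurableT_comp (measurable_iint_row_mx g0 mg) maff).
- by move=> x _; exact: iint_ge0.
- by rewrite lee_fin exprn_ge0// invr_ge0 ltW.
rewrite (@ge0_integral_affine c v0 G c0); last 2 first.
- exact: measurable_iint_row_mx.
- by move=> x; exact: iint_ge0.
by rewrite muleA -EFinM -exprSr.
Qed.

End AffineChangeOfVariables.

(** * Sums of integrable functions *)

Section SumOfIntegrable.
Context dd (T : measurableType dd) {R : realType} (mu : {measure set T -> \bar R}).
Local Open Scope ereal_scope.

(** The sum [G] of the absolute values is integrable, hence finite almost everywhere, so the series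
    converges almost everywhere to some [f]. Against a function [h] bounded by [B], the partial sums
    are dominated by [B G], and dominated convergence applies. *)
Lemma sum_integrable_cvg (u : nat -> T -> R) :
  (forall l, mu.-integrable setT (EFin \o u l)) ->
  \sum_(l <oo) \int[mu]_x `|u l x|%:E < +oo ->
  exists f : T -> R, mu.-integrable setT (EFin \o f) /\
    forall (h : T -> R) (B : R), measurable_fun setT h -> (forall x, `|h x| <= B)%R ->
      (fun n => \int[mu]_x (h x * \sum_(l < n) u l x)%R)%R @ \oo --> (\int[mu]_x (h x * f x))%R.
Proof.
move=> iu su.
have mu_ l : measurable_fun setT (u l) by apply/measurable_EFinP; exact: measurable_int (iu l).
pose G x := \sum_(l <oo) `|u l x|%:E.
have mabs l : measurable_fun setT (fun x => `|u l x|%:E).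
  by apply/measurable_EFinP; exact: measurableT_comp.
have mG : measurable_fun setT G.
  by apply: ge0_emeasurable_sum => // *; rewrite lee_fin.
have G0 x : 0 <= G x by apply: nneseries_ge0 => *; rewrite lee_fin.
have iG : mu.-integrable setT G.
  apply/integrableP; split => //.
  under eq_integral do rewrite gee0_abs//.
  by rewrite integral_nneseries// => *; rewrite lee_fin.
pose D := [set x | G x < +oo].
have mD : measurable D.
  by rewrite -[D]setTI; apply: emeasurable_fun_infty_o => //.
have psum x n : D x -> (\sum_(l < n) `|u l x| <= fine (G x))%R.
  move=> Dx; rewrite -lee_fin fineK ?ge0_fin_numE// -sumEFin.
  rewrite -(big_mkord xpredT (fun l => `|u l x|%:E)).
  by apply: nneseries_lim_ge => *; rewrite lee_fin.
have cvgu x : D x -> cvgn (fun n => \sum_(l < n) u l x)%R.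
  move=> Dx.
  have : cvgn [normed series (fun l => u l x)].
    apply: nondecreasing_is_cvgn.
      by apply: nondecreasing_series => i _ _; exact: normr_ge0.
    by exists (fine (G x)) => _ [n _ <-]; rewrite /normed_series_of seriesEord /=; exact: psum.
  by move/normed_cvg; rewrite seriesEord; apply.
(* Cutting off outside [D] makes the sequence converge at every point, so its limit is
   measurable. *)
pose s n x := (\1_D x * \sum_(l < n) u l x)%R.
pose f x := limn (fun n => s n x).
have scvg x : (fun n => s n x) @ \oo --> f x.
  suff : cvgn (fun n => s n x) by [].
  rewrite /s indicE; case: (boolP (x \in D)) => xD.
    by under eq_fun do rewrite mul1r; apply: cvgu; rewrite inE in xD.
  under eq_fun do rewrite mul0r; exact: is_cvg_cst.
have msum n : measurable_fun setT (fun x => \sum_(l < n) u l x)%R.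
  by apply: measurable_sum.
have mf : measurable_fun setT f.
  apply: (@measurable_fun_cvg _ _ _ _ s) => [n|x _]; last exact: scvg.
  by apply: measurable_funM => //; exact: measurable_indic.
have aeD : {ae mu, forall x, D x}.
  have := integrable_ae measurableT iG.
  by apply: filterS => x /(_ I); rewrite ge0_fin_numE.
have key (h : T -> R) (B : R) : measurable_fun setT h -> (forall x, `|h x| <= B)%R ->
   mu.-integrable setT (EFin \o (fun x => h x * f x)%R) /\
   (fun n => \int[mu]_x (h x * \sum_(l < n) u l x)%R%:E) @ \oo --> \int[mu]_x (h x * f x)%R%:E.
  move=> mh hB.
  have [] := @dominated_convergence _ _ _ mu setT measurableT
    (fun n x => (h x * \sum_(l < n) u l x)%R%:E) (fun x => (h x * f x)%R%:E)
    (fun x => B%:E * G x).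
  - by move=> n; apply/measurable_EFinP; exact: measurable_funM.
  - by apply/measurable_EFinP; exact: measurable_funM.
  - apply: filterS aeD => x Dx _; apply: cvg_EFin; first exact: nearW.
    apply: cvgM; first exact: cvg_cst.
    have := scvg x; rewrite /s indicE mem_set//.
    by under [X in X @ _ --> _ -> _]eq_fun do rewrite mul1r.
  - exact: integrableZl.
  - apply: filterS aeD => x Dx n _.
    rewrite -(fineK (x := G x)) ?ge0_fin_numE// -EFinM /= lee_fin normrM.
    apply: ler_pM => //.
    by apply: le_trans (psum x n Dx); exact: ler_norm_sum.
  - by [].
(* The case [h = 1] yields the integrability of [f] itself. *)
have [if1 _] := key (cst 1%R) 1%R (measurable_cst _) (fun=> ltac:(by rewrite normr1)).
have if_ : mu.-integrable setT (EFin \o f).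
  by apply: eq_integrable if1 => // x _ /=; rewrite mul1r.
exists f; split => // h B mh hB.
have [ihf cv] := key h B mh hB.
rewrite /Rintegral; apply: fine_cvg; rewrite fineK//.
exact: integrable_fin_num.
Qed.

End SumOfIntegrable.

(** * Complex-valued integrals through real and imaginary parts *)

Section ComplexParts.
Context {R : realType}.
Local Notation Re := complex.Re.
Local Notation Im := complex.Im.

Lemma ReD (z w : R[i]) : Re (z + w) = Re z + Re w.
Proof. by case: z; case: w. Qed.

Lemma ImD (z w : R[i]) : Im (z + w) = Im z + Im w.
Proof. by case: z; case: w. Qed.

Lemma Re_sum I (s : seq I) (P : pred I) (F : I -> R[i]) :
  Re (\sum_(i <- s | P i) F i) = \sum_(i <- s | P i) Re (F i).
Proof. exact: (big_morph _ ReD). Qed.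

Lemma Im_sum I (s : seq I) (P : pred I) (F : I -> R[i]) :
  Im (\sum_(i <- s | P i) F i) = \sum_(i <- s | P i) Im (F i).
Proof. exact: (big_morph _ ImD). Qed.

Lemma Re_rcM r (z : R[i]) : Re (rc r * z) = r * Re z.
Proof. by case: z => x y /=; rewrite mul0r subr0. Qed.

Lemma Im_rcM r (z : R[i]) : Im (rc r * z) = r * Im z.
Proof. by case: z => x y /=; rewrite mul0r addr0. Qed.

Lemma Re_conjM (z w : R[i]) : Re (conjc z * w) = Re z * Re w + Im z * Im w.
Proof. by case: z; case: w => a b c e /=; rewrite mulNr opprK. Qed.

Lemma Im_conjM (z w : R[i]) : Im (conjc z * w) = Re z * Im w - Im z * Re w.
Proof. by case: z; case: w => a b c e /=; rewrite mulNr. Qed.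

Lemma complex_ext (z w : R[i]) : Re z = Re w -> Im z = Im w -> z = w.
Proof. by case: z; case: w => a b c e /= -> ->. Qed.

Lemma normr_Re_le (z : R[i]) : `|Re z| <= cabs z.
Proof.
case: z => x y; rewrite /cabs /= -sqrtr_sqr ler_sqrt ?lerDl ?sqr_ge0//.
by rewrite addr_ge0 ?sqr_ge0.
Qed.

Lemma normr_Im_le (z : R[i]) : `|Im z| <= cabs z.
Proof.
case: z => x y; rewrite /cabs /= -sqrtr_sqr ler_sqrt ?lerDr ?sqr_ge0//.
by rewrite addr_ge0 ?sqr_ge0.
Qed.

Lemma cabs_le (z : R[i]) : cabs z <= `|Re z| + `|Im z|.
Proof.
case: z => x y; rewrite /cabs /= -[leRHS]ger0_norm ?addr_ge0//.
rewrite -sqrtr_sqr ler_sqrt ?sqr_ge0//.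
rewrite sqrrD !real_normK ?num_real// -addrA lerD2l addrC lerDl.
by rewrite mulrn_wge0// mulr_ge0.
Qed.

Lemma cabs_ge0 (z : R[i]) : 0 <= cabs z.
Proof. by case: z => x y; exact: sqrtr_ge0. Qed.

End ComplexParts.

Section ComplexIntegral.
Context {R : realType} {d : nat} (mu : {measure set (borelRow R d) -> \bar R}).
Hypothesis pintE : forall g : 'rV[R]_d -> \bar R, (forall x, 0 <= g x)%E ->
  measurable_fun [set: borelRow R d] (g : borelRow R d -> \bar R) ->
  pint g = (\int[mu]_x g x)%E.
Local Notation P := 'rV[R]_d.
Local Notation Re := complex.Re.
Local Notation Im := complex.Im.

Lemma rintE (h : P -> R) :
  mu.-integrable setT (EFin \o (h : borelRow R d -> R)) -> rint h = (\int[mu]_x h x)%R.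
Proof.
move=> ih; have mh := measurable_int mu ih.
rewrite /rint /Rintegral integralE fineB; last 2 first.
- exact: integrable_pos_fin_num.
- exact: integrable_neg_fin_num.
rewrite !pintE; last 4 first.
- by move=> x; rewrite lee_fin le_max lexx orbT.
- apply/measurable_EFinP; apply: measurable_maxr => //.
  by apply: measurableT_comp => //; apply/measurable_EFinP.
- by move=> x; rewrite lee_fin le_max lexx orbT.
- by apply/measurable_EFinP; apply: measurable_maxr => //; apply/measurable_EFinP.
by congr (fine _ - fine _); apply: eq_integral => x _; rewrite ?funeposE ?funenegE /= EFin_max.
Qed.

Definition cintegrable (f : P -> R[i]) :=
  mu.-integrable setT (EFin \o (fun x : borelRow R d => Re (f x))) /\
  mu.-integrable setT (EFin \o (fun x : borelRow R d => Im (f x))).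

Lemma cintegrable0 : cintegrable (fun=> 0).
Proof. by split; exact: integrable0. Qed.

Lemma cintE (f : P -> R[i]) : cintegrable f ->
  cint f = Complex (\int[mu]_x Re (f x))%R (\int[mu]_x Im (f x))%R.
Proof. by case=> fr fi; rewrite /cint !rintE. Qed.

Lemma cintegrableD f g : cintegrable f -> cintegrable g -> cintegrable (fun x => f x + g x).
Proof.
move=> [fr fi] [gr gi]; split.
  rewrite (_ : _ \o _ = (EFin \o (fun x : borelRow R d => Re (f x))) \+
     (EFin \o (fun x : borelRow R d => Re (g x))))%E; last first.
    by apply/funext => x /=; rewrite ReD.
  exact: integrableD.
rewrite (_ : _ \o _ = (EFin \o (fun x : borelRow R d => Im (f x))) \+
   (EFin \o (fun x : borelRow R d => Im (g x))))%E; last first.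
  by apply/funext => x /=; rewrite ImD.
exact: integrableD.
Qed.

Lemma cintD f g : cintegrable f -> cintegrable g ->
  cint (fun x => f x + g x) = cint f + cint g.
Proof.
move=> cf cg; rewrite !cintE//; last exact: cintegrableD.
case: cf cg => [fr fi] [gr gi]; apply: complex_ext => /=.
  by under eq_Rintegral do rewrite ReD; rewrite RintegralD.
by under eq_Rintegral do rewrite ImD; rewrite RintegralD.
Qed.

Lemma cintegrableZ (r : R) f : cintegrable f -> cintegrable (fun x => rc r * f x).
Proof.
move=> [fr fi]; split.
  rewrite (_ : _ \o _ = fun x : borelRow R d => (r%:E * (Re (f x))%:E)%E).
    exact: integrableZl.
  by apply/funext => x /=; rewrite Re_rcM.
rewrite (_ : _ \o _ = fun x : borelRow R d => (r%:E * (Im (f x))%:E)%E).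
  exact: integrableZl.
by apply/funext => x /=; rewrite Im_rcM.
Qed.

Lemma cintZ (r : R) f : cintegrable f -> cint (fun x => rc r * f x) = rc r * cint f.
Proof.
move=> cf; rewrite !cintE//; last exact: cintegrableZ.
case: cf => [fr fi]; apply: complex_ext => /=.
  by under eq_Rintegral do rewrite Re_rcM; rewrite RintegralZl// mul0r subr0.
by under eq_Rintegral do rewrite Im_rcM; rewrite RintegralZl// mul0r addr0.
Qed.

Lemma cintegrable_sum I (s : seq I) (F : I -> P -> R[i]) :
  (forall i, cintegrable (F i)) -> cintegrable (fun x => \sum_(i <- s) F i x).
Proof.
move=> iF; elim: s => [|i s IH].
  by under eq_fun do rewrite big_nil; exact: cintegrable0.
by under eq_fun do rewrite big_cons; exact: cintegrableD.
Qed.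

Lemma cint_sum I (s : seq I) (F : I -> P -> R[i]) :
  (forall i, cintegrable (F i)) ->
  cint (fun x => \sum_(i <- s) F i x) = \sum_(i <- s) cint (F i).
Proof.
move=> iF; elim: s => [|i s IH].
  under eq_fun do rewrite big_nil; rewrite big_nil cintE; last exact: cintegrable0.
  by rewrite /Rintegral integral0.
under eq_fun do rewrite big_cons; rewrite big_cons -IH cintD//.
exact: cintegrable_sum.
Qed.

Definition cbounded (g : P -> R[i]) := cmeasurable g /\ exists B, forall x, cabs (g x) <= B.

Lemma cbounded_parts g : cbounded g ->
  exists B, [/\ measurable_fun [set: borelRow R d] (fun x : borelRow R d => Re (g x)),
    measurable_fun [set: borelRow R d] (fun x : borelRow R d => Im (g x)),
    forall x, `|Re (g x)| <= B & forall x, `|Im (g x)| <= B].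
Proof.
move=> [[mr mi] [B gB]]; exists B; split.
- exact/borel_funE.
- exact/borel_funE.
- by move=> x; rewrite (le_trans (normr_Re_le _)).
- by move=> x; rewrite (le_trans (normr_Im_le _)).
Qed.

Lemma integrable_boundedM (h f : borelRow R d -> R) B :
  measurable_fun setT h -> (forall x, `|h x| <= B) ->
  mu.-integrable setT (EFin \o f) -> mu.-integrable setT (EFin \o (fun x => h x * f x)).
Proof.
move=> mh hB fi.
have := integrableMr measurableT mh _ fi; apply.
by exists B; split; [exact: num_real|move=> M BM x _ /=; rewrite (le_trans (hB x))// ltW].
Qed.

Lemma cintegrable_conjM g f : cbounded g -> cintegrable f ->
  cintegrable (fun x => conjc (g x) * f x).
Proof.
move=> /cbounded_parts[B [mr mi rB iB]] [fr fi]; split.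
  rewrite (_ : _ \o _ = (EFin \o (fun x : borelRow R d => Re (g x) * Re (f x))%R) \+
     (EFin \o (fun x : borelRow R d => Im (g x) * Im (f x))%R))%E; last first.
    by apply/funext => x /=; rewrite Re_conjM EFinD.
  by apply: integrableD => //; exact: integrable_boundedM.
rewrite (_ : _ \o _ = (EFin \o (fun x : borelRow R d => Re (g x) * Im (f x))%R) \-
   (EFin \o (fun x : borelRow R d => Im (g x) * Re (f x))%R))%E; last first.
  by apply/funext => x /=; rewrite Im_conjM EFinB.
by apply: integrableB => //; exact: integrable_boundedM.
Qed.

(** Splitting the pairing into four real integrals lets the real convergence lemma be applied to
    each of them. *)
Lemma cint_conjM g f : cbounded g -> cintegrable f ->
  cint (fun x => conjc (g x) * f x) =
  Complex ((\int[mu]_x (Re (g x) * Re (f x))) + (\int[mu]_x (Im (g x) * Im (f x))))%R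
    ((\int[mu]_x (Re (g x) * Im (f x))) - (\int[mu]_x (Im (g x) * Re (f x))))%R.
Proof.
move=> bg cf; rewrite cintE; last exact: cintegrable_conjM.
case: cf => fr fi; have [B [mr mi rB iB]] := cbounded_parts bg.
apply: complex_ext => /=.
  under eq_Rintegral do rewrite Re_conjM.
  by rewrite RintegralD//; exact: (@integrable_boundedM _ _ B).
under eq_Rintegral do rewrite Im_conjM.
by rewrite RintegralB//; exact: (@integrable_boundedM _ _ B).
Qed.

(** The parts are summed separately, and pairing with a bounded [g] passes to the limit.
    Orthogonality will make the pairings with the partial sums eventually constant, so the limit is
    stated for that case only. *)
Lemma csum_integrable (F : nat -> P -> R[i]) :
  (forall l, cintegrable (F l)) ->
  (\sum_(l <oo) \int[mu]_x `|Re (F l x)|%:E < +oo)%E ->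
  (\sum_(l <oo) \int[mu]_x `|Im (F l x)|%:E < +oo)%E ->
  exists f, cintegrable f /\
    forall g z n0, cbounded g ->
      (forall n, (n0 <= n)%N -> \sum_(l < n) cint (fun x => conjc (g x) * F l x) = z) ->
      cint (fun x => conjc (g x) * f x) = z.
Proof.
move=> iF sr si.
have [fr [ifr frP]] := sum_integrable_cvg (fun l => (iF l).1) sr.
have [fi [ifi fiP]] := sum_integrable_cvg (fun l => (iF l).2) si.
exists (fun x => Complex (fr x) (fi x)); split => // g z n0 bg gz.
have cf : cintegrable (fun x => Complex (fr x) (fi x)) by [].
rewrite cint_conjM//.
have [B [mr mi rB iB]] := cbounded_parts bg.
pose S n x : R[i] := \sum_(l < n) F l x.
have cS n : cintegrable (S n) by exact: cintegrable_sum.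
have zE n : (n0 <= n)%N -> cint (fun x => conjc (g x) * S n x) = z.
  move=> n0n; rewrite -(gz n n0n) -cint_sum; last by move=> i; exact: cintegrable_conjM.
  by congr cint; apply/funext => x; rewrite mulr_sumr.
have ReS n x : Re (S n x) = \sum_(l < n) Re (F l x) by exact: Re_sum.
have ImS n x : Im (S n x) = \sum_(l < n) Im (F l x) by exact: Im_sum.
have hRR := frP _ _ mr rB; have hII := fiP _ _ mi iB.
have hRI := fiP _ _ mr rB; have hIR := frP _ _ mi iB.
apply: complex_ext => /=.
  rewrite -(cvg_lim (@Rhausdorff R) (cvgD hRR hII)); apply: cvg_lim => //.
  apply: cvg_near_cst; exists n0 => // n /= n0n.
  rewrite -(zE n n0n) cint_conjM//=.
  by congr (_ + _); apply: eq_Rintegral => x _; rewrite ?ReS ?ImS.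
rewrite -(cvg_lim (@Rhausdorff R) (cvgB hRI hIR)); apply: cvg_lim => //.
apply: cvg_near_cst; exists n0 => // n /= n0n.
rewrite -(zE n n0n) cint_conjM//=.
by congr (_ - _); apply: eq_Rintegral => x _; rewrite ?ReS ?ImS.
Qed.

End ComplexIntegral.

(** * Bounded functions of compact support *)

Section CompactSupport.
Context {R : realType}.
Local Notation Re := complex.Re.
Local Notation Im := complex.Im.

Lemma coord_le_edist d (x y : 'rV[R]_d) i : `|x 0 i - y 0 i| <= Defs.edist x y.
Proof.
rewrite /edist -sqrtr_sqr ler_sqrt; last by apply: sumr_ge0 => *; exact: sqr_ge0.
by rewrite (bigD1 i)//= lerDl; apply: sumr_ge0 => *; exact: sqr_ge0.
Qed.

(** A sup-norm ball rather than a Euclidean one: being a product of segments, it has an indicator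
    whose iterated integral factors. *)
Definition box (M : R) n : set 'rV[R]_n := [set x | forall i, `|x 0 i| <= M].
Arguments box M n : clear implicits.

Lemma iint_box_lty n (M : R) : (iint (fun x : 'rV[R]_n => (\1_(box M n) x)%:E) < +oo)%E.
Proof.
elim: n => [|n IH] /=; first by rewrite ltry.
(* The section of the box at first coordinate [t] is the lower-dimensional box if [t] lies in
   [[-M, M]], and is empty otherwise. *)
have h t : iint (fun y : 'rV[R]_n => (\1_(box M (1 + n)) (row_mx (const_mx t : 'rV_1) y))%:E) =
   ((\1_(`[- M, M]%classic) t)%:E * iint (fun x : 'rV[R]_n => (\1_(box M n) x)%:E))%E.
  rewrite [in RHS]indicE; case: (boolP (t \in _)) => tM.
    rewrite mul1e; congr iint; apply/funext => y; congr EFin.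
    rewrite !indicE; congr ((_ : bool)%:R).
    apply/idP/idP; rewrite !inE => /= yM i.
      by have := yM (rshift 1 i); rewrite row_mxEr.
    case: (splitP i) => j ij.
      rewrite (_ : i = lshift n j) ?row_mxEl ?mxE; last exact: val_inj.
      by move: tM; rewrite inE /= in_itv /= ler_norml.
    by rewrite (_ : i = rshift 1 j) ?row_mxEr//; exact: val_inj.
  rewrite mul0e.
  transitivity (iint (fun y : 'rV[R]_n => 0%E)).
    congr iint; apply/funext => y; congr EFin; rewrite indicE.
    case: (boolP (_ \in _)) => //; rewrite inE => /= /(_ (lshift n 0)).
    rewrite row_mxEl mxE => tM'; move: tM.
    by rewrite notin_setE /= in_itv /= -ler_norml tM'.
  by elim: n {IH} => //= n IH; rewrite IH integral0.
under eq_integral do rewrite h.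
rewrite ge0_integralZr//; last 2 first.
- by apply/measurable_EFinP; exact: measurable_indic.
- by apply: iint_ge0 => x; rewrite lee_fin.
rewrite integral_indic// setIT /= lebesgue_measure_itv /=.
rewrite lte_mul_pinfty//.
  by case: ifP => // MM; rewrite -EFinD lee_fin subr_ge0 ltW// -lte_fin.
by case: ifP.
Qed.

Lemma measurable_box n (M : R) : measurable (box M n : set (borelRow R n)).
Proof.
rewrite (_ : box M n = \bigcap_(i in [set: 'I_n])
    ((fun x : borelRow R n => (x : 'rV[R]_n) 0 i : R) @^-1` `[- M, M]%classic)); last first.
  apply/seteqP; split => x /=.
    by move=> h i _; rewrite /= in_itv /= -ler_norml.
  by move=> h i; have := h i I; rewrite /= in_itv /= -ler_norml.
apply: fin_bigcap_measurable => [|i _]; first by have := @finite_finset (ordinal n); apply.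
by rewrite -[_ @^-1` _]setTI; exact: measurable_coord.
Qed.

Lemma compact_box n (M : R) : compact (box M n).
Proof.
rewrite (_ : box M n = [set v | forall i, `[- M, M]%classic (v ord0 i)]); last first.
  by apply/seteqP; split => x /= h i; have := h i; rewrite /= in_itv /= -ler_norml.
by apply: (@rV_compact R n (fun=> `[- M, M]%classic)) => i; exact: segment_compact.
Qed.

Lemma continuous_bounded_box n (M : R) (g : 'rV[R]_n -> R) : continuous g ->
  exists B, forall x, box M n x -> `|g x| <= B.
Proof.
move=> cg.
have : compact (g @` box M n).
  apply: continuous_compact (@compact_box n M).
  by apply: continuous_subspaceT.
move=> /compact_bounded[B [_ hB]]; exists (B + 1) => x xM.
by apply: (hB (B + 1)); [rewrite ltrDl|exists x].
Qed.

Lemma compact_support_box d (g : 'rV[R]_d -> R[i]) : compact_support g ->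
  exists M, forall x, ~ box M d x -> g x = 0.
Proof.
move=> [M gM]; exists M => x xM; apply: gM; rewrite ltNge; apply/negP => h; apply: xM => i.
by have := coord_le_edist x 0 i; rewrite mxE subr0 => /le_trans; apply.
Qed.

Lemma continuous_compact_cbounded d (g : 'rV[R]_d -> R[i]) :
  continuous (fun x => Re (g x)) -> continuous (fun x => Im (g x)) ->
  compact_support g -> cbounded g.
Proof.
move=> cr ci /compact_support_box[M gM]; split.
  by split; apply/borel_funE; exact: continuous_measurable_row.
have [B1 hB1] := continuous_bounded_box M cr.
have [B2 hB2] := continuous_bounded_box M ci.
exists (`|B1| + `|B2|) => x.
have [xM|xM] := pselect (box M d x).
  rewrite (le_trans (cabs_le _))// lerD//.
    by rewrite (le_trans (hB1 x xM))// ler_norm.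
  by rewrite (le_trans (hB2 x xM))// ler_norm.
by rewrite gM// (le_trans (cabs_le _))//= normr0 addr0 addr_ge0.
Qed.

Section Integrable.
Context {d : nat} (mu : {measure set (borelRow R d) -> \bar R}).
Hypothesis pintE : forall g : 'rV[R]_d -> \bar R, (forall x, 0 <= g x)%E ->
  measurable_fun [set: borelRow R d] (g : borelRow R d -> \bar R) ->
  pint g = (\int[mu]_x g x)%E.

Lemma mu_box_lty (M : R) : (mu (box M d) < +oo)%E.
Proof.
have mb := measurable_box M (n := d).
rewrite -[X in mu X]setIT -integral_indic// -pintE; first exact: iint_box_lty.
  by move=> x; rewrite lee_fin.
by apply/measurable_EFinP; exact: measurable_indic.
Qed.

Lemma cbounded_compact_cintegrable (g : 'rV[R]_d -> R[i]) :
  cbounded g -> compact_support g -> cintegrable mu g.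
Proof.
move=> bg /compact_support_box[M gM]; have [B [mr mi rB iB]] := cbounded_parts bg.
have ib : mu.-integrable setT (EFin \o (\1_(box M d) : borelRow R d -> R)).
  apply/integrableP; split.
    by apply/measurable_EFinP; apply: measurable_indic; exact: measurable_box.
  under eq_integral do rewrite /= ger0_norm//.
  by rewrite integral_indic// ?setIT ?mu_box_lty//; exact: measurable_box.
(* This exhibits [g] as a bounded function times the integrable indicator of a box of finite
   measure. *)
have gE x : g x = rc (\1_(box M d) x) * g x.
  rewrite indicE; case: (boolP (x \in _)) => xM.
    by apply: complex_ext; rewrite ?Re_rcM ?Im_rcM mul1r.
  by rewrite gM ?mulr0//; move: xM; rewrite notin_setE.
split.
  rewrite (_ : _ \o _ = EFin \o (fun x : borelRow R d => Re (g x) * \1_(box M d) x)%R).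
    exact: (integrable_boundedM mr rB).
  by apply/funext => x /=; rewrite {1}gE Re_rcM mulrC.
rewrite (_ : _ \o _ = EFin \o (fun x : borelRow R d => Im (g x) * \1_(box M d) x)%R).
  exact: (integrable_boundedM mi iB).
by apply/funext => x /=; rewrite {1}gE Im_rcM mulrC.
Qed.

End Integrable.
End CompactSupport.

(** * Dilations of functions and of the multiresolution spaces *)

Section Dilation.
Context {R : realType} {d : nat}.
Local Notation P := 'rV[R]_d.
Local Notation Zd := 'rV[int]_d.
Local Notation Re := complex.Re.
Local Notation Im := complex.Im.

Lemma rint_affine (c : R) (v : P) (h : P -> R) : 0 < c ->
  measurable_fun [set: borelRow R d] (h : borelRow R d -> R) ->
  rint (fun x => h (c *: x + v)) = c^-1 ^+ d * rint h.
Proof.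
move=> c0 mh; rewrite /rint.
have k0 : 0 < c^-1 ^+ d by rewrite exprn_gt0// invr_gt0.
(* This also holds at infinite [y], where both sides are 0, so measurability suffices for the change
   of variables and no integrability is assumed. *)
have fineZ (y : \bar R) : fine ((c^-1 ^+ d)%:E * y)%E = c^-1 ^+ d * fine y.
  by case: y => [r| |] //=; rewrite ?gt0_muley ?gt0_muleNy ?lte_fin//= mulr0.
have aff (k : P -> R) : measurable_fun [set: borelRow R d] (k : borelRow R d -> R) ->
    pint (fun x => (Num.max (k (c *: x + v)) 0)%:E) =
    ((c^-1 ^+ d)%:E * pint (fun x => (Num.max (k x) 0)%:E))%E.
  move=> mk; apply: (iint_affine v (g := fun x => (Num.max (k x) 0)%:E)) => //.
    by move=> x; rewrite lee_fin le_max lexx orbT.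
  by apply/measurable_EFinP; apply: measurable_maxr.
rewrite aff// (aff (fun x => - h x)); last exact: measurableT_comp.
by rewrite !fineZ mulrBr.
Qed.

Lemma cint_affine (c : R) (v : P) (g : P -> R[i]) : 0 < c -> cmeasurable g ->
  cint (fun x => g (c *: x + v)) = rc (c^-1 ^+ d) * cint g.
Proof.
move=> c0 [/borel_funE mr /borel_funE mi]; apply: complex_ext.
  by rewrite Re_rcM /= (rint_affine v c0 mr).
by rewrite Im_rcM /= (rint_affine v c0 mi).
Qed.

Lemma cmeasurable_affine (c : R) (v : P) (g : P -> R[i]) :
  cmeasurable g -> cmeasurable (fun x => g (c *: x + v)).
Proof.
move=> [/borel_funE mr /borel_funE mi].
by split; apply/borel_funE; [exact: (measurableT_comp mr (measurable_affine c v))|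
  exact: (measurableT_comp mi (measurable_affine c v))].
Qed.

Lemma cbounded_affine (c : R) (v : P) (g : P -> R[i]) :
  cbounded g -> cbounded (fun x => g (c *: x + v)).
Proof.
move=> [mg [B gB]]; split; first exact: cmeasurable_affine.
by exists B.
Qed.

Section Integrable.
Variable mu : {measure set (borelRow R d) -> \bar R}.
Hypothesis pintE : forall g : 'rV[R]_d -> \bar R, (forall x, 0 <= g x)%E ->
  measurable_fun [set: borelRow R d] (g : borelRow R d -> \bar R) ->
  pint g = (\int[mu]_x g x)%E.

Lemma integral_abs_affine (c : R) (v : P) (h : P -> R) : 0 < c ->
  measurable_fun [set: borelRow R d] (h : borelRow R d -> R) ->
  (\int[mu]_x `|h (c *: (x : P) + v)%R|%:E = (c^-1 ^+ d)%:E * \int[mu]_x `|h x|%:E)%E.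
Proof.
move=> c0 mh.
have mabs : measurable_fun [set: borelRow R d] (fun x : borelRow R d => `|h x|%:E).
  by apply/measurable_EFinP; exact: measurableT_comp.
rewrite -!pintE//.
  exact: (iint_affine v (g := fun x => `|h x|%:E)).
exact: (measurableT_comp mabs (measurable_affine c v)).
Qed.

Lemma cintegrable_affine (c : R) (v : P) (g : P -> R[i]) : 0 < c -> cmeasurable g ->
  cintegrable mu g -> cintegrable mu (fun x => g (c *: x + v)).
Proof.
move=> c0 mg [/integrableP[_ ir] /integrableP[_ ii]].
have [mr' mi'] := cmeasurable_affine c v mg.
case: mg => /borel_funE mr /borel_funE mi.
split; apply/integrableP; split; try by apply/measurable_EFinP; exact/borel_funE.
  rewrite (integral_abs_affine v c0 mr) lte_mul_pinfty// lee_fin.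
  by rewrite exprn_ge0// invr_ge0 ltW.
rewrite (integral_abs_affine v c0 mi) lte_mul_pinfty// lee_fin.
by rewrite exprn_ge0// invr_ge0 ltW.
Qed.

End Integrable.

Lemma MRA_nested (V : int -> set (P -> R[i])) phi (l : nat) f : MRA V phi -> V 0 f -> V (Posz l) f.
Proof.
move=> [_ [inc _]] V0f; elim: l => // l IH.
by rewrite -addn1 PoszD; exact: inc.
Qed.

(** The dilation axiom read backwards lowers the level by one while replacing [f] by [f(./2)]; this
    is iterated [l] times. *)
Lemma MRA_dilate (V : int -> set (P -> R[i])) phi (l : nat) f : MRA V phi -> V (Posz l) f ->
  V 0 (fun x => f (2^-1 ^+ l *: x)).
Proof.
move=> [_ [_ [dil _]]]; elim: l f => [|l IH] f.
  by under eq_fun do rewrite expr0 scale1r.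
rewrite -addn1 PoszD => Vf.
rewrite (_ : (fun _ => _) = fun x => (fun y => f (2^-1 *: y)) (2^-1 ^+ l *: x)); last first.
  by apply/funext => x; rewrite /= scalerA -exprS addn1.
apply: (IH (fun y => f (2^-1 *: y))); apply/dil.
rewrite (_ : (fun _ => _) = f)//.
by apply/funext => x; rewrite scalerA mulVf ?scale1r.
Qed.

End Dilation.

(** * Orthogonality relations and wavelet synthesis *)

Section Atoms.
Context {R : realType} {d : nat}.
Local Notation P := 'rV[R]_d.
Local Notation Zd := 'rV[int]_d.
Local Notation Re := complex.Re.
Local Notation Im := complex.Im.

Lemma cmeasurable_conjM (g f : P -> R[i]) : cmeasurable g -> cmeasurable f ->
  cmeasurable (fun x => conjc (g x) * f x).
Proof.
move=> [/borel_funE gr /borel_funE gi] [/borel_funE fr /borel_funE fi].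
split; apply/borel_funE.
  under eq_fun do rewrite Re_conjM.
  by apply: measurable_funD; exact: measurable_funM.
under eq_fun do rewrite Im_conjM.
by apply: measurable_funB; exact: measurable_funM.
Qed.

Variables (V : int -> set (P -> R[i])) (phi : P -> R[i]).
Variable psi : 'I_(2 ^ d - 1) -> P -> R[i].
Hypothesis mra : MRA V phi.
Hypothesis wav : associated_wavelets V psi.
Hypothesis phib : cbounded phi.
Hypothesis psib : forall i, cbounded (psi i).
Hypothesis psic : forall i, compact_support (psi i).
Variable mu : {measure set (borelRow R d) -> \bar R}.
Hypothesis pintE : forall g : 'rV[R]_d -> \bar R, (forall x, 0 <= g x)%E ->
  measurable_fun [set: borelRow R d] (g : borelRow R d -> \bar R) ->
  pint g = (\int[mu]_x g x)%E.

Lemma exp2_gt0 l : 0 < (2 : R) ^+ l. Proof. by rewrite exprn_gt0. Qed.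

Lemma atom_cbounded i l k : cbounded (fun x => psi i (diln l k x)).
Proof. exact: (cbounded_affine (2 ^+ l) (- zpt k) (psib i)). Qed.

Lemma atom_cintegrable i l k : cintegrable mu (fun x => psi i (diln l k x)).
Proof.
apply: (cintegrable_affine pintE (- zpt k) (exp2_gt0 l)); first exact: (psib i).1.
exact: (cbounded_compact_cintegrable pintE (psib i) (psic i)).
Qed.

Lemma phi_cbounded k : cbounded (fun x => phi (x - zpt k)).
Proof.
have := cbounded_affine 1 (- zpt k) phib.
by under eq_fun do rewrite scale1r.
Qed.

(** Rescaling by [2^l] sends the atom to a translate of [psi i], which is
    orthogonal to [V 0], and sends [phi(. - m)], an element of [V 0 `<=` V l],
    into [V 0]. *)
Lemma inner_phi_atom i l k m :
  cint (fun x => conjc (phi (x - zpt m)) * psi i (diln l k x)) = 0.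
Proof.
pose h x := phi (x - zpt m).
have V0h : V 0 h by have [_ [_ [_ [_ [_ [_ [+ _]]]]]]] := mra; exact.
have /(MRA_dilate mra) V0 := MRA_nested l mra V0h.
have /(_ _ V0) := (wav.1 i k).2.
pose G x := conjc (h (2^-1 ^+ l *: x)) * psi i (x - zpt k).
have mG : cmeasurable G.
  apply: cmeasurable_conjM.
    have := cmeasurable_affine (2^-1 ^+ l) 0 (phi_cbounded m).1.
    by under eq_fun do rewrite addr0.
  have := cmeasurable_affine 1 (- zpt k) (psib i).1.
  by under eq_fun do rewrite scale1r.
have := cint_affine 0 (exp2_gt0 l) mG.
rewrite /inner => + inn0.
have -> : cint G = 0 by rewrite -inn0; congr cint; apply/funext => x; rewrite /G mulrC.
rewrite mulr0 => <-; congr cint; apply/funext => x; rewrite /G addr0.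
by rewrite scalerA -exprMn mulVf// expr1n scale1r.
Qed.

(** The atoms are not normalized in [L^2]. The orthonormal family carries the real factors [A] and
    [A'], which come out of the integral and are then divided out. *)
Lemma cint_atom_atom i l k i' l' k' :
  cint (fun x => conjc (psi i' (diln l' k' x)) * psi i (diln l k x)) =
  if [&& i == i', l == l' & k == k'] then rc (2 ^- (d * l)) else 0.
Proof.
have := wav.2.1.2 (i, Posz l, k) (i', Posz l', k').
set A := (2 : R) `^ ((d%:R * (Posz l)%:~R) / 2).
pose A' := (2 : R) `^ ((d%:R * (Posz l')%:~R) / 2).
rewrite /inner /=.
rewrite (_ : (fun _ => _) =
  (fun x => rc (A * A') * (conjc (psi i' (diln l' k' x)) * psi i (diln l k x)))); last first.
  apply/funext => x; rewrite -/A -/A' /dilz /diln -!exprnP.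
  set u := psi i _; set w := psi i' _.
  case: u => a b; case: w => a' b' /=; apply: complex_ext => /=; ring.
rewrite (cintZ pintE); last first.
  by apply: cintegrable_conjM; [exact: atom_cbounded|exact: atom_cintegrable].
have A0 : 0 < A by rewrite powR_gt0.
have A'0 : 0 < A' by rewrite powR_gt0.
set z := cint _ => zE.
have {zE} -> : z = rc (A * A')^-1 * ((i, Posz l, k) == (i', Posz l', k'))%:R.
  rewrite -zE; case: (z) => a b; apply: complex_ext => /=; field;
  by rewrite ?gt_eqF// mulr_gt0.
rewrite !xpair_eqE eqz_nat -andbA; case: ifPn => [/and3P[_ /eqP ll _]|_]; last by rewrite mulr0.
(* On the diagonal [A' = A = 2^(d l / 2)], so the product of the factors is [2^(d l)]. *)
rewrite mulr1; congr (rc _^-1); rewrite /A' -ll -/A -powRD ?pnatr_eq0 ?implybT//.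
rewrite -splitr -pmulrn -natrM powR_mulrn//.
Qed.

Lemma sum_filter_uniq (s : seq Zd) (z : R[i]) k' : uniq s ->
  \sum_(k <- s) (if k == k' then z else 0) = if k' \in s then z else 0.
Proof.
move=> us; rewrite -big_mkcond /=; case: ifP => ks.
  by rewrite -big_filter filter_pred1_uniq// big_seq1.
rewrite big1_seq// => k /andP[/eqP -> ks']; by rewrite ks' in ks.
Qed.

(** Level [l] has [L^1] norm at most a constant times [|b l| #(S l) 2^(-d l)], so the series
    converges in [L^1]. Pairing with the bounded functions [phi(. - k)] and with the atoms then
    gives the coefficients by orthogonality. *)
Lemma synthesis (i1 : 'I_(2 ^ d - 1)) (S : nat -> seq Zd) (b : nat -> R) :
  (forall l, uniq (S l)) ->
  (\sum_(l <oo) (`|b l| * (size (S l))%:R * 2 ^- (d * l))%:E < +oo)%E ->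
  exists f, [/\ Defs.locally_integrable f,
    forall k, Ccoef phi f k = 0 &
    forall i l k, ccoef psi f i l k = if (i == i1) && (k \in S l) then rc (b l) else 0].
Proof.
move=> uS sb.
pose F l x := \sum_(k <- S l) rc (b l) * psi i1 (diln l k x).
have iF l : cintegrable mu (F l).
  by apply: cintegrable_sum => k; apply: cintegrableZ; exact: atom_cintegrable.
have [mr mi] := (psib i1).1.
have [ir ii] := cbounded_compact_cintegrable pintE (psib i1) (psic i1).
(* Stated for an abstract real-linear [part], in order to be used for both the real and the
   imaginary part. *)
have cvF (part : R[i] -> R) :
    (forall I (s : seq I) G, part (\sum_(i <- s) G i) = \sum_(i <- s) part (G i)) ->
    (forall r z, part (rc r * z) = r * part z) ->
    measurable_fun [set: borelRow R d] (fun x : borelRow R d => part (psi i1 x)) ->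
    mu.-integrable setT (EFin \o (fun x : borelRow R d => part (psi i1 x))) ->
    (\sum_(l <oo) \int[mu]_x `|part (F l x)|%:E < +oo)%E.
  move=> part_sum partM mpart /integrableP[_]; rewrite /comp.
  under eq_integral do rewrite [abse _]/=.
  set J := (\int[mu]_x _)%E => Joo.
  have mat l k : measurable_fun [set: borelRow R d]
      (fun x : borelRow R d => part (psi i1 (diln l k x))).
    exact: (measurableT_comp mpart (measurable_affine (2 ^+ l) (- zpt k))).
  have J0 : (0 <= J)%E by apply: integral_ge0 => x _; rewrite lee_fin.
  have JE : J = (fine J)%:E by rewrite fineK// ge0_fin_numE.
  (* Triangle inequality over [S l]; by rescaling, each atom has [2^(-d l)] times the integral [J]
     of the undilated wavelet part. *)
  have le1 l : (\int[mu]_x `|part (F l x)|%:E <=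
      (`|b l| * (size (S l))%:R * 2 ^- (d * l))%:E * J)%E.
    apply: (@le_trans _ _ (\int[mu]_x \sum_(k <- S l) `|b l * part (psi i1 (diln l k x))|%:E)%E).
      apply: ge0_le_integral => //.
      - apply/measurable_EFinP; apply: measurableT_comp => //.
        under eq_fun do rewrite part_sum.
        apply: measurable_sum => k.
        by under eq_fun do rewrite partM; exact: measurable_funM.
      - apply: emeasurable_sum => k; apply/measurable_EFinP.
        by apply: measurableT_comp => //; exact: measurable_funM.
      - by move=> x _; rewrite part_sum sumEFin lee_fin (le_trans (ler_norm_sum _ _ _))//;
          under eq_bigr do rewrite partM.
    rewrite ge0_integral_sum//; last first.
      by move=> k; apply/measurable_EFinP; apply: measurableT_comp => //; exact: measurable_funM.
    rewrite (eq_bigr (fun=> (`|b l| * 2 ^- (d * l) * fine J)%:E)) => [|k _]; last first.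
      under eq_integral do rewrite normrM EFinM.
      rewrite ge0_integralZl//; last by apply/measurable_EFinP; exact: measurableT_comp.
      rewrite (integral_abs_affine pintE (- zpt k) (exp2_gt0 l) mpart) -/J JE -!EFinM.
      by rewrite exprVn -exprM (mulnC l) mulrA.
    rewrite sumEFin JE -EFinM lee_fin big_const_seq count_predT iter_addr_0 -mulr_natr.
    by rewrite le_eqVlt; apply/orP; left; apply/eqP; ring.
  apply: le_lt_trans (lee_nneseries _ (fun l _ => le1 l)) _.
    by move=> l _ _; apply: integral_ge0 => x _; rewrite lee_fin.
  rewrite JE; under eq_eseriesr do rewrite muleC.
  rewrite nneseriesZl; last by move=> l _; rewrite lee_fin !mulr_ge0// invr_ge0 exprn_ge0.
  by rewrite lte_mul_pinfty// -JE.
have [f [fint fP]] := csum_integrable pintE iF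
  (cvF _ (fun I s G => Re_sum s xpredT G) (@Re_rcM R) ((borel_funE _).1 mr) ir)
  (cvF _ (fun I s G => Im_sum s xpredT G) (@Im_rcM R) ((borel_funE _).1 mi) ii).
exists f; split.
- have [fr fi] := fint.
  have mfr := measurable_int mu fr; have mfi := measurable_int mu fi.
  have {}mfr : measurable_fun [set: borelRow R d] (fun x : borelRow R d => Re (f x)).
    exact/measurable_EFinP.
  have {}mfi : measurable_fun [set: borelRow R d] (fun x : borelRow R d => Im (f x)).
    exact/measurable_EFinP.
  split; first by split; exact/borel_funE.
  move=> M.
  have msqrt : measurable_fun setT (@Num.sqrt R).
    by apply: measurable_realfun.continuous_measurable_fun; exact: sqrt_continuous.
  have mcabs : measurable_fun [set: borelRow R d] (fun x : borelRow R d => cabs (f x)).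
    rewrite (_ : (fun _ => _) = Num.sqrt \o
        (fun x : borelRow R d => Re (f x) ^+ 2 + Im (f x) ^+ 2)); last first.
      by apply/funext => x /=; rewrite /cabs /=; case: (f x).
    apply: measurableT_comp => //.
    by apply: measurable_funD; exact: measurable_funX.
  have medist : measurable_fun [set: borelRow R d] (fun x : borelRow R d => Defs.edist (x : P) 0).
    apply: (measurableT_comp msqrt).
    apply: measurable_sum => i; apply: measurable_funX; apply: measurable_funB => //.
    exact: measurable_coord.
  have mball : measurable_fun [set: borelRow R d]
      (fun x : borelRow R d => if Defs.edist (x : P) 0 <= M then cabs (f x) else 0).
    by apply: measurable_fun_ifT => //; exact: measurable_fun_ler.
  rewrite pintE; last 2 first.
  - by move=> x; rewrite lee_fin; case: ifP => // _; exact: cabs_ge0.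
  - exact/measurable_EFinP.
  apply: (@le_lt_trans _ _ (\int[mu]_x (`|Re (f x)|%:E + `|Im (f x)|%:E))%E).
    apply: ge0_le_integral => //.
    - by move=> x _; rewrite lee_fin; case: ifP => // _; exact: cabs_ge0.
    - exact/measurable_EFinP.
    - by apply/measurable_EFinP; apply: measurable_funD; exact: measurableT_comp.
    - move=> x _; rewrite -EFinD lee_fin; case: ifP => _; first exact: cabs_le.
      by rewrite addr_ge0.
  rewrite ge0_integralD//; last 2 first.
  - by apply/measurable_EFinP; exact: measurableT_comp.
  - by apply/measurable_EFinP; exact: measurableT_comp.
  by move: fr fi => /integrableP[_ fr] /integrableP[_ fi]; rewrite lte_add_pinfty.
- move=> k; rewrite /Ccoef; apply: (fP _ 0 0%N (phi_cbounded k)) => n _.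
  rewrite big1// => l _; rewrite /F.
  under [X in cint X]eq_fun do rewrite mulr_sumr.
  rewrite (cint_sum pintE) => [|j]; last first.
    apply: cintegrable_conjM; first exact: phi_cbounded.
    by apply: cintegrableZ; exact: atom_cintegrable.
  rewrite big1// => j _; under [X in cint X]eq_fun do rewrite mulrCA.
  rewrite (cintZ pintE) ?inner_phi_atom ?mulr0//.
  by apply: cintegrable_conjM; [exact: phi_cbounded|exact: atom_cintegrable].
- move=> i l k; rewrite /ccoef.
  have inF m : cint (fun x => conjc (psi i (diln l k x)) * F m x) =
      if [&& i == i1, m == l & k \in S m] then rc (b m) * rc (2 ^- (d * l)) else 0.
    rewrite /F; under [X in cint X]eq_fun do rewrite mulr_sumr.
    rewrite (cint_sum pintE) => [|j]; last first.
      apply: cintegrable_conjM; first exact: atom_cbounded.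
      by apply: cintegrableZ; exact: atom_cintegrable.
    transitivity (\sum_(j <- S m) if j == k then
        (if (i == i1) && (m == l) then rc (b m) * rc (2 ^- (d * l)) else 0) else 0).
      apply: eq_bigr => j _; under [X in cint X]eq_fun do rewrite mulrCA.
      rewrite (cintZ pintE) ?cint_atom_atom; last first.
        by apply: cintegrable_conjM; [exact: atom_cbounded|exact: atom_cintegrable].
      rewrite (eq_sym i1); case: (i == i1); case: eqP => [->|_]; case: (j == k);
        by rewrite /= ?mulr0.
    rewrite sum_filter_uniq//.
    by case: (k \in S m); case: (i == i1); case: (m == l).
  (* The pairing with the partial sums is constant from index [l.+1] on, the first whose sum
     includes level [l]. The factor [2^(d l)] in [ccoef] cancels the squared norm of the atom. *)
  rewrite (fP _ (if (i == i1) && (k \in S l) then rc (b l) * rc (2 ^- (d * l)) else 0)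
    l.+1 (atom_cbounded i l k)) => [|n ln].
    case: ifP => _; rewrite ?mulr0//.
    by apply: complex_ext => /=; field; rewrite expf_neq0.
  rewrite (bigD1 (Ordinal ln))//= inF eqxx /= big1 ?addr0// => m ml.
  rewrite inF; case: ifP => // /and3P[_ /eqP ml' _].
  by move: ml; rewrite -val_eqE /= ml' eqxx.
Qed.

End Atoms.

(** * Box counting *)

Section BoxCounting.
Context {R : realType} {d : nat}.
Local Notation P := 'rV[R]_d.
Local Notation Zd := 'rV[int]_d.

(** The infimum defining the dimension supplies an [eps] below which all the logarithmic ratios are
    at most some [alpha' < alpha]; this is used at the scales [2^-l < eps]. The factor 2 leaves room
    to extract an actual cover from the infimum [Ncov]. *)
Lemma upper_box_dim_cover (G : set P) (alpha : R) : 0 < alpha ->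
  (upper_box_dim G < alpha%:E)%E ->
  exists alpha', 0 < alpha' < alpha /\ exists l0, forall l : nat, (l0 <= l)%N ->
    exists n (U : 'I_n -> set P), [/\ G `<=` \bigcup_i U i,
      forall i, (diam (U i) <= (2 ^- l)%:E)%E & n%:R < 2 * 2 `^ (alpha' * l%:R)].
Proof.
move=> alpha0 /ereal_inf_lt[_ /= [eps /andP[eps0 eps1] <-]].
set v := ereal_sup _ => valpha.
have [alpha' [a'0 a'1 va']] : exists alpha', [/\ 0 < alpha', alpha' < alpha & (v <= alpha'%:E)%E].
  case: v valpha => [r| |] //=.
    (* The supremum may be nonpositive; the maximum with [alpha / 2] keeps the exponent positive and
       still below [alpha]. *)
    rewrite lte_fin => ra; exists (Num.max (alpha / 2) r).
    rewrite lt_max divr_gt0//= gt_max ra andbT lee_fin le_max lexx orbT; split => //.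
    by rewrite ltr_pdivrMr// ltr_pMr// ltr1n.
  by exists (alpha / 2); rewrite divr_gt0// ltr_pdivrMr// ltr_pMr// ltr1n leNye.
exists alpha'; rewrite a'0 a'1; split => //.
have [m _ hm] : \forall n \near \oo, (2^-1 : R) ^+ n < eps.
  have := @cvg_expr R 2^-1; rewrite ger0_norm ?invf_lt1 ?ltr1n//.
  move=> /(_ isT) /cvgrPdist_lt /(_ _ eps0).
  by apply: filterS => n; rewrite sub0r normrN ger0_norm.
(* The successor forces [l > 0], so that [- ln (2^-l)] is positive and can be divided by. *)
exists m.+1 => l ml.
have l0 : (0 < l)%N by exact: leq_ltn_trans ml.
have deps : (2 : R) ^- l < eps by rewrite -exprVn; apply: hm => /=; exact: ltnW.
have d0 : 0 < (2 : R) ^- l by rewrite invr_gt0 exprn_gt0.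
have ln2 : 0 < ln (2 : R) by rewrite ln_gt0// ltr1n.
have lnE : - ln ((2 : R) ^- l) = l%:R * ln 2.
  by rewrite lnV ?posrE ?exprn_gt0// lnXn// opprK mulr_natl.
have lln : 0 < (l%:R * ln (2 : R)) by rewrite mulr_gt0// ltr0n.
have Nle : (Ncov (2 ^- l) G <= (2 `^ (alpha' * l%:R))%:E)%E.
  have : (elog (Ncov (2 ^- l) G) * ((- ln ((2 : R) ^- l))^-1)%:E <= alpha'%:E)%E.
    apply: le_trans va'; apply: ereal_sup_ubound; exists (2 ^- l) => //=.
    by rewrite d0 deps.
  rewrite lnE.
  have N0 : (0 <= Ncov (2 ^- l) G)%E.
    by apply: le_ereal_inf_tmp => _ [n _ <-]; rewrite lee_fin.
  (* A zero covering number has logarithm [-oo] but satisfies the bound trivially; an infinite one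
     would make the ratio [+oo]. *)
  case: (Ncov _ _) N0 => [r| |] //=.
    rewrite lee_fin => r0; case: eqP => [-> _|/eqP rn0]; first by rewrite lee_fin powR_ge0.
    rewrite -EFinM !lee_fin ler_pdivrMr// => h.
    have r1 : 0 < r by rewrite lt_neqAle eq_sym rn0.
    by rewrite -ler_ln ?posrE ?powR_gt0// ln_powR -mulrA.
  by move=> _; rewrite gt0_mulye ?lte_fin ?invr_gt0.
have /ereal_inf_lt[_ /= [n [U [GU dU]] <-]] : (Ncov (2 ^- l) G < (2 * 2 `^ (alpha' * l%:R))%:E)%E.
  by apply: le_lt_trans Nle _; rewrite lte_fin ltr_pMl ?powR_gt0// ltr1n.
by rewrite lte_fin => nlt; exists n, U.
Qed.

Lemma edist_le_diam (U : set P) x y (e : R) :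
  (diam U <= e%:E)%E -> U x -> U y -> Defs.edist x y <= e.
Proof.
move=> dU Ux Uy; rewrite -lee_fin; apply: le_trans dU.
by apply: ereal_sup_ubound; exists x => //; exists y.
Qed.

(** In each coordinate, the index of a closed cube meeting [U] is one of the four
    integers [f - 2, ..., f + 1], where [f] is the floor of [2^l u_i] for a fixed
    [u] in [U]. *)
Lemma cubes_meeting_small_set l (U : set P) : (diam U <= (2 ^- l)%:E)%E ->
  exists c : 'rV['I_4]_d -> Zd, forall k, (cube l k `&` U) !=set0 -> exists t, k = c t.
Proof.
move=> dU; have [->|/set0P[u Uu]] := eqVneq U set0.
  by exists (fun=> 0) => k [x []].
pose fl i : int := Num.floor (2 ^+ l * u 0 i).
exists (fun t : 'rV['I_4]_d => \row_i (fl i + (t 0 i : nat)%:Z - 2)) => k [x [kx Ux]].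
have e0 : 0 < (2 : R) ^+ l by rewrite exprn_gt0.
have ki i : fl i - 2 <= k 0 i < fl i + 2.
  have := coord_le_edist x u i.
  move=> /le_trans /(_ (edist_le_diam dU Ux Uu)) xu.
  have /andP[] := kx i; rewrite ler_pdivrMr// ler_pdivlMr// => k1 k2.
  have /andP[f1 f2] := real_floor_itv (num_real (2 ^+ l * u 0 i)).
  rewrite -/(fl i) in f1 f2.
  have : `|2 ^+ l * x 0 i - 2 ^+ l * u 0 i| <= 1.
    by rewrite -mulrBr normrM (gtr0_norm e0) mulrC -ler_pdivlMr// mul1r.
  rewrite ler_norml => /andP[h1 h2].
  rewrite mulrC in k1; rewrite mulrC in k2.
  rewrite -(ler_int R) -(ltr_int R) rmorphB rmorphD /=.
  move: f2; rewrite rmorphD /= => f2.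
  by apply/andP; split; lra.
have ti i : (`|(k 0 i - (fl i - 2))%R| < 4)%N by have := ki i; lia.
exists (\row_i Ordinal (ti i)); apply/rowP => i; rewrite !mxE /=.
by have := ki i; lia.
Qed.

Lemma finite_uniq_seq (T : choiceType) (A : set T) : finite_set A ->
  exists s : seq T, uniq s /\ forall x, x \in s <-> A x.
Proof.
move=> fA; exists (finmap.enum_fset (fset_set A)); split; first exact: finmap.fset_uniq.
by move=> x; rewrite in_fset_set// inE.
Qed.

(** A cube meeting [G] meets some [U i], and each [U i] accounts for at most [4^d] indices. *)
Lemma card_cubes_meeting (G : set P) l n (U : 'I_n -> set P) (s : seq Zd) :
  G `<=` \bigcup_i U i -> (forall i, (diam (U i) <= (2 ^- l)%:E)%E) -> uniq s ->
  (forall k, k \in s -> (cube l k `&` G) !=set0) -> (size s <= n * 4 ^ d)%N.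
Proof.
move=> GU dU us sG.
have /choice[c hc] := fun i => cubes_meeting_small_set (dU i).
pose D := ('I_n * 'rV['I_4]_d)%type.
have : (size s <= size [seq c t.1 t.2 | t : D])%N.
  apply: uniq_leq_size => // k /sG [x [kx /GU[i _ Ux]]].
  have [|t ->] := hc i k; first by exists x.
  by apply/mapP; exists (i, t) => //; rewrite mem_enum.
by rewrite size_map -cardE card_prod card_ord card_mx card_ord mul1n.
Qed.

End BoxCounting.

(** * Assembly *)

Section Assembly.
Context {R : realType} {d : nat}.
Local Notation P := 'rV[R]_d.
Local Notation Zd := 'rV[int]_d.
Local Notation Re := complex.Re.
Local Notation Im := complex.Im.

(** The cubes of [Theta n] meeting [G] are counted at scale [2^-(t + N n)], while their images under
    [mu] index wavelets of level [N n]. At a point of [K], each selected wavelet times [a] is either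
    at least 1 or zero; a point of [G] lies in a selected cube. *)
Lemma adapted_cantor_cover (psi1 : P -> R[i]) (d' : R) K t N a Theta mu (G : set P) alpha :
  adapted_cantor_data psi1 d' K t N a Theta mu -> G `<=` K -> 0 < alpha ->
  (upper_box_dim G < alpha%:E)%E ->
  exists (alpha' C : R) n0 (S : nat -> seq Zd), [/\ 0 < alpha' < alpha, 0 < C,
    (forall l, uniq (S l)) /\ (forall l, (size (S l))%:R <= C * 2 `^ (alpha' * l%:R)),
    forall l k x, k \in S l -> K x -> 0 <= rc a * psi1 (diln l k x) &
    forall n x, (n0 <= n)%N -> G x ->
      exists2 k, k \in S (N * n)%N & 1 <= rc a * psi1 (diln (N * n) k x)].
Proof.
move=> [_ [_ [_ [_ [N1 [_ [fin [inj [_ [KE psiP]]]]]]]]]] GK alpha0 dimG.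
have [alpha' [a'01 [l0 cov]]] := upper_box_dim_cover alpha0 dimG.
pose A n : set Zd := [set k | Theta n k /\ (cube (t + N * n) k `&` G) !=set0].
(* The lists [s n] enumerate these cubes; [S] places their images at the levels [N n] with [n >= l0]
   and is empty at all others. *)
have finA n : finite_set (A n) by apply: sub_finite_set (fin n) => k [].
have /choice[s sP] := fun n => finite_uniq_seq (finA n).
pose S l := if (N %| l)%N && (l0 <= l %/ N)%N then map (mu (l %/ N)%N) (s (l %/ N)%N) else [::].
have SN n : (l0 <= n)%N -> S (N * n)%N = map (mu n) (s n).
  by move=> ln; rewrite /S dvdn_mulr// mulKn// ln.
have memS l k : k \in S l -> exists n lam, [/\ l = (N * n)%N, Theta n lam & k = mu n lam].
  rewrite /S; case: ifP => // /andP[/dvdnP[n ->] _]; rewrite mulnK//.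
  move=> /mapP[lam lams ->]; exists n, lam; split => //; first by rewrite mulnC.
  by have [_ /(_ lam)[/(_ lams)[]]] := sP n.
(* The constant collects the 2 of the covering bound, the loss due to the level offset [t], and the
   [4^d] cubes per covering set. *)
exists alpha', (2 * 2 `^ (alpha' * t%:R) * 4 ^+ d), l0, S; split => //.
- split=> l; rewrite /S; case: ifPn => //.
  + move=> /andP[/dvdnP[n ->] _]; rewrite mulnK//; have [us sA] := sP n.
    rewrite map_inj_in_uniq// => u v /sA[uT _] /sA[vT _]; exact: inj.
  + move=> /andP[/dvdnP[n ->]]; rewrite mulnK// size_map => ln.
    have [us sA] := sP n.
    (* Since [N >= 1], the condition [l0 <= n] makes the finer scale [t + N n] admissible for the
       covering bound. *)
    have tl : (l0 <= t + N * n)%N.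
      by rewrite (leq_trans ln)// (leq_trans (leq_pmull n N1))// leq_addl.
    have [m [U [GU dU mlt]]] := cov _ tl.
    have sz : (size (s n) <= m * 4 ^ d)%N.
      by apply: (card_cubes_meeting GU dU us) => k /sA[].
    apply: (@le_trans _ _ (m%:R * 4 ^+ d)); first by rewrite -natrX -natrM ler_nat.
    rewrite mulrAC ler_wpM2r ?exprn_ge0//.
    apply: (le_trans (ltW mlt)); rewrite -mulrA ler_pM2l// -powRD ?pnatr_eq0 ?implybT//.
    by rewrite -mulrDr -natrD mulnC.
  + by move=> _; rewrite !mulr_ge0 ?powR_ge0 ?exprn_ge0.
- move=> l k x /memS[n [lam [-> Tlam ->]]] Kx.
  have Knx : Kn t N Theta n x by move: Kx; rewrite KE => /(_ n); apply.
  have [h1 h0] := psiP n x lam Knx Tlam.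
  have [/h1|/h0 ->] := pselect (cube (t + N * n) lam x); last by rewrite mulr0.
  exact: le_trans.
- move=> n x ln Gx.
  have Knx : Kn t N Theta n x by have := GK _ Gx; rewrite KE => /(_ n); apply.
  have [lam Tlam clam] := Knx.
  exists (mu n lam); last exact: (psiP n x lam Knx Tlam).1.
  rewrite SN//; apply: map_f; have [_ sA] := sP n.
  by apply/sA; split => //; exists x.
Qed.

(** Once [n] bounds every coordinate of every index in [s], the box sum is exactly the finite sum,
    so the limit is that of an eventually constant sequence. *)
Lemma zsum_finite (F : Zd -> R[i]) (s : seq Zd) : uniq s ->
  (forall k, k \notin s -> F k = 0) -> zsum F = \sum_(k <- s) F k.
Proof.
move=> us Fs.
have [n0 n0P] : exists n0, forall k i, k \in s -> (`|(k 0 i)%R| <= n0)%N.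
  exists (\max_(k <- s) \max_(i < d) `|(k 0 i)%R|%N) => k i ks.
  rewrite (big_rem k)//= leq_max; apply/orP; left.
  exact: (@leq_bigmax _ (fun i : 'I_d => `|(k 0 i)%R|%N)).
have bE n : (n0 <= n)%N -> boxsum F n = \sum_(k <- s) F k.
  move=> nn; rewrite /boxsum.
  pose c (t : 'rV['I_(2 * n).+1]_d) : Zd :=
    map_mx (fun i : 'I_(2 * n).+1 => (i : nat)%:Z - n%:Z) t.
  rewrite -/c -[LHS](big_map c xpredT F).
  have ci : injective c.
    move=> u v uv; apply/rowP => i; move/rowP: uv => /(_ i); rewrite !mxE => uv.
    by apply: val_inj; move: uv => /=; lia.
  rewrite (bigID (mem s))/= addrC big1 ?add0r; last by move=> k; exact: Fs.
  rewrite -big_filter; apply: perm_big; apply: uniq_perm => //.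
    by rewrite filter_uniq// map_inj_uniq// /index_enum -enumT enum_uniq.
  move=> k; rewrite mem_filter; apply/andP/idP => [[]//|ks]; split => //.
  have kn i : (`|(k 0 i + n%:Z)%R| < (2 * n).+1)%N.
    by have := n0P k i ks; lia.
  have aux (z : int) : (`|z| <= n)%N -> z = (`|(z + n%:Z)%R|%N)%:Z - n%:Z by lia.
  apply/mapP; exists (\row_i Ordinal (kn i)); first by rewrite mem_index_enum.
  apply/rowP => i; rewrite !mxE /=; apply: aux; exact: leq_trans (n0P k i ks) nn.
have h (g : R[i] -> R) : limn (fun n => g (boxsum F n)) = g (\sum_(k <- s) F k).
  apply: cvg_lim => //; apply: cvg_near_cst; exists n0 => // n /= nn.
  by rewrite bE.
by rewrite /zsum !h; case: (\sum_(_ <- _) _).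
Qed.

Lemma Pj_finite phi (psi : 'I_(2 ^ d - 1) -> P -> R[i]) f i1
    (S : nat -> seq Zd) (b : nat -> R) j x :
  (forall l, uniq (S l)) -> (forall k, Ccoef phi f k = 0) ->
  (forall i l k, ccoef psi f i l k = if (i == i1) && (k \in S l) then rc (b l) else 0) ->
  Pj phi psi f j x = \sum_(l < j) \sum_(k <- S l) rc (b l) * psi i1 (diln l k x).
Proof.
move=> uS C0 cE; rewrite /Pj (@zsum_finite _ [::])// => [|k _]; last by rewrite C0 mul0r.
rewrite big_nil add0r; apply: eq_bigr => l _.
rewrite (bigD1 i1)//= [X in _ + X]big1 ?addr0 => [|i ii1]; last first.
  rewrite (@zsum_finite _ [::]) ?big_nil// => k _.
  by rewrite cE (negbTE ii1) mul0r.
rewrite (@zsum_finite _ (S l))// => [|k kS]; last by rewrite cE (negbTE kS) andbF mul0r.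
by apply: eq_big_seq => k kS; rewrite cE eqxx kS.
Qed.

Lemma eps_j_finite (psi : 'I_(2 ^ d - 1) -> P -> R[i]) f i1 (S : seq Zd) b s p l : 1 <= p ->
  uniq S ->
  (forall i k, ccoef psi f i l k = if (i == i1) && (k \in S) then rc b else 0) ->
  eps_j s p psi f l =
    (2 `^ ((s - d%:R / p) * l%:R) * ((size S)%:R `^ p^-1 * `|b|))%:E.
Proof.
move=> p1 uS cE; have p0 : 0 < p by exact: lt_le_trans p1.
rewrite /eps_j EFinM; congr (_ * _)%E.
pose s' := [seq (i1, k) | k <- S].
have us' : uniq s' by rewrite map_inj_uniq// => u v [].
have ms' t : (t \in s') = (t.1 == i1) && (t.2 \in S).
  apply/mapP/andP => [[k kS ->]//|]; case: t => i k /= [/eqP -> kS]; by exists k.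
have -> : \esum_(t in [set: 'I_(2 ^ d - 1) * Zd]) ((cabs (ccoef psi f t.1 l t.2)) `^ p)%:E =
    \esum_(t in [set` s']) (`|b| `^ p)%:E.
  rewrite [RHS]esum_mkcond; apply: eq_esum => t _.
  rewrite cE -ms' mem_setE; case: ifP => _.
    by rewrite /cabs /= expr0n /= addr0 sqrtr_sqr.
  (* Vanishing coefficients contribute 0 because [p] is nonzero; a zero exponent would give 1. *)
  by rewrite /cabs /= expr0n /= addr0 sqrtr0 powR0// gt_eqF.
rewrite esum_fset; [|exact: finite_seq|by move=> i _; rewrite lee_fin powR_ge0].
rewrite -fsbig_seq// sumEFin big_const_seq count_predT iter_addr_0 size_map.
rewrite poweR_EFin -[X in (X `^ _)%:E]mulr_natl powRM// ?powR_ge0//.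
by rewrite -(powRrM `|b|) mulfV ?gt_eqF// powRr1.
Qed.

Lemma lp_norm0 p : 1 <= p -> lp_norm p (fun _ : Zd => 0 : R[i]) = 0%E.
Proof.
move=> p1; have p0 : 0 < p by exact: lt_le_trans p1.
rewrite /lp_norm esum1 ?poweR0r ?invr_neq0 ?gt_eqF// => k _.
by rewrite /cabs /= expr0n /= addr0 sqrtr0 powR0// gt_eqF.
Qed.

End Assembly.

(** * Geometric series and growth rates *)

Section Sequences.
Context {R : realType}.

Lemma nneseries_geometric_le (A q : R) : 0 <= A -> 0 <= q < 1 ->
  (\sum_(l <oo) (A * q ^+ l)%:E <= (A / (1 - q))%:E)%E.
Proof.
move=> A0 /andP[q0 q1]; apply: lime_le.
  by apply: is_cvg_nneseries => n _ _; rewrite lee_fin mulr_ge0// exprn_ge0.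
apply: nearW => n; rewrite sumEFin lee_fin -mulr_sumr ler_wpM2l//.
have q1' : 0 < 1 - q by rewrite subr_gt0.
rewrite -(ler_pM2l q1') mulfV ?gt_eqF// big_mkord.
by rewrite -opprB mulNr -subrX1 opprB gerBl exprn_ge0.
Qed.

Lemma limn_einf_ge (u : nat -> \bar R) (b : R) :
  (forall e, 0 < e -> \forall j \near \oo, ((b - e)%:E <= u j)%E) ->
  (b%:E <= limn_einf u)%E.
Proof.
move=> h; apply/lee_subgt0Pr => e e0.
have [n _ hn] := h e e0.
rewrite limn_einf_lim; have /cvg_lim -> // := @cvg_einfs_sup R u.
apply: (@le_trans _ _ (einfs u n)); last by apply: ereal_sup_ubound; exists n.
by apply: le_ereal_inf_tmp => _ [m /= nm <-]; rewrite -EFinB; exact: hn.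
Qed.

Lemma powR2_natM (x : R) l : 2 `^ (x * l%:R) = (2 `^ x) ^+ l.
Proof. by rewrite powRrM powR_mulrn// powR_ge0. Qed.

Lemma powR2_gt1 (x : R) : 0 < x -> 1 < 2 `^ x.
Proof.
move=> x0; rewrite -ltr_ln ?posrE ?powR_gt0// ln1 ln_powR mulr_gt0// ln_gt0//.
by rewrite ltr1n.
Qed.

End Sequences.

Lemma smooth_cbounded (R : realType) d r (g : 'rV[R]_d -> R[i]) :
  smooth_of_order r g -> compact_support g -> cbounded g.
Proof.
by case: r => [|r] [[cr _] [ci _]]; exact: continuous_compact_cbounded.
Qed.

(** The lower bound is only known at multiples of [N]. Replacing [j] by the last multiple before it
    costs at most the factor [2^(beta N)], which disappears after taking logarithms and dividing by
    [j]. *)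
Lemma log_growth_liminf (R : realType) (z : nat -> R[i]) (c beta : R) (N n0 : nat) :
  0 < c -> (0 < N)%N ->
  (forall j n, (n0 <= n)%N -> (N * n < j)%N -> c * 2 `^ (beta * (N * n)%:R) <= cabs (z j)) ->
  0 < beta ->
  (beta%:E <= limn_einf (fun j : nat =>
     elog (cabs (z j))%:E * ((j%:R * ln (2 : R))^-1)%:E))%E.
Proof.
move=> c0 N0 zP beta0; apply: limn_einf_ge => e e0.
have ln2 : 0 < ln (2 : R) by rewrite ln_gt0// ltr1n.
(* From [N n >= j - N], the goal [ln c + beta N n ln 2 >= (beta - e) j ln 2] follows as soon as
   [j >= D]. *)
pose D : R := (beta * N%:R * ln 2 - ln c) / (e * ln 2).
exists (Num.truncn `|D| + N * n0.+1).+1 => // j /= jlarge.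
have j0 : (0 < j)%N by lia.
(* The largest [n] with [N n < j]; the inequality is strict because [Pj] at [j] only sums levels
   below [j]. *)
pose n := (j.-1 %/ N)%N.
have n0n : (n0 <= n)%N by rewrite leq_divRL//; lia.
have Nnj : (N * n < j)%N by rewrite mulnC; have := leq_divM j.-1 N; rewrite -/n; lia.
have jNn : (j <= N * n + N)%N by have := ltn_ceil j.-1 N0; rewrite -/n mulSn; lia.
have w0 : 0 < c * 2 `^ (beta * (N * n)%:R) by rewrite mulr_gt0// powR_gt0.
have le := zP j n n0n Nnj; have zj0 := lt_le_trans w0 le.
rewrite /elog gt_eqF// -EFinM lee_fin.
have jln : 0 < j%:R * ln (2 : R) by rewrite mulr_gt0// ltr0n.
rewrite ler_pdivlMr//.
apply: (@le_trans _ _ (ln c + beta * (N * n)%:R * ln 2)); last first.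
  by rewrite -ln_powR -lnM ?posrE ?powR_gt0// ler_ln.
have Dj : D <= j%:R.
  apply: (le_trans (ler_norm _)); apply: (le_trans (ltW (truncnS_gt _))).
  by rewrite ler_nat (leq_trans _ jlarge)// ltnS leq_addr.
move: Dj; rewrite ler_pdivrMr ?mulr_gt0// => Dj.
have : beta * ln 2 * j%:R <= beta * ln 2 * ((N * n)%:R + N%:R).
  by rewrite ler_pM2l ?mulr_gt0// -natrD ler_nat.
by lra.
Qed.

(** * Choice of the coefficients and proof of the estimates *)

Theorem theorem4p2 (R : realType) (d : nat)
  (V : int -> set ('rV[R]_d -> R[i])) (phi : 'rV[R]_d -> R[i])
  (psi : 'I_(2 ^ d - 1) -> 'rV[R]_d -> R[i]) (i1 : 'I_(2 ^ d - 1))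
  (s p d' : R) (K : set 'rV[R]_d) (t N : nat) (a : R)
  (Theta : nat -> set 'rV[int]_d) (mu : nat -> 'rV[int]_d -> 'rV[int]_d) :
  MRA V phi -> associated_wavelets V psi ->
  (nat_of_ord i1 = 0)%N ->
  smooth_of_order (Num.truncn s).+1 phi ->
  (forall i, smooth_of_order (Num.truncn s).+1 (psi i)) ->
  compact_support phi -> (forall i, compact_support (psi i)) ->
  0 < s -> 1 <= p -> 0 < d%:R - s * p ->
  d%:R - s * p < d' < d%:R ->
  adapted_cantor_data (psi i1) d' K t N a Theta mu ->
  forall (alpha : R), 0 < alpha < d%:R - s * p ->
  forall G : set 'rV[R]_d, G `<=` K -> (upper_box_dim G < alpha%:E)%E ->
  exists f : 'rV[R]_d -> R[i],
    in_besov_s1p s p phi psi f /\ (besov_norm s p phi psi f <= 1)%E /\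
    (forall x (j : nat), K x -> 0 <= Pj phi psi f j x) /\
    (forall x, G x ->
       (((d%:R - s * p - alpha) / p)%:E <=
        limn_einf (fun j : nat =>
          elog (cabs (Pj phi psi f j x))%:E * ((j%:R * ln (2 : R))^-1)%:E))%E).
Proof.
move=> mra wav _ smphi smpsi cphi cpsi s0 p1 dsp0 _ cantor alpha /andP[alpha0 alpha1] G GK dimG.
have p0 : 0 < p by exact: lt_le_trans p1.
have phib := smooth_cbounded smphi cphi.
have psib i := smooth_cbounded (smpsi i) (cpsi i).
have [m [_ pintE]] := @exists_measure_iint R d.
have [alpha' [C [n0 [S [/andP[a'0 a'1] C0 [uS szS] Kge Gge]]]]] :=
  adapted_cantor_cover cantor GK alpha0 dimG.
have [_ [_ [_ [_ [N1 [a0 _]]]]]] := cantor.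
pose beta := (d%:R - s * p - alpha) / p.
have beta0 : 0 < beta by rewrite divr_gt0// subr_gt0.
(* The ratio of the Besov series: [(s - d/p) + alpha'/p + beta = -(alpha - alpha')/p]. *)
pose q : R := 2 `^ (- ((alpha - alpha') / p)).
have q01 : 0 <= q < 1.
  rewrite powR_ge0 /= /q powRN invf_lt1 ?powR_gt0//.
  by rewrite powR2_gt1// divr_gt0// subr_gt0.
pose A := `|a| * C `^ p^-1.
have A0 : 0 < A by rewrite mulr_gt0 ?normr_gt0 ?powR_gt0.
(* Level [l] of the Besov norm will be at most [c A q^l], so this [c] makes the geometric bound sum
   to exactly 1. *)
have [c c0 cA] : exists2 c, 0 < c & 1 - q = c * A.
  exists ((1 - q) / A); last by rewrite divfK// gt_eqF.
  by rewrite divr_gt0// subr_gt0; case/andP: q01.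
(* The factor [a] is included because the sign information on [K] concerns [a psi1]. *)
pose b l := c * a * 2 `^ (beta * l%:R).
have normb l : `|b l| = c * `|a| * 2 `^ (beta * l%:R).
  by rewrite /b !normrM (gtr0_norm c0) (ger0_norm (powR_ge0 _ _)).
have sumb : (\sum_(l <oo) (`|b l| * (size (S l))%:R * 2 ^- (d * l))%:E < +oo)%E.
  (* The ratio of the [L^1] bounds; its exponent is at most [- s p - (alpha - alpha')], hence
     negative. *)
  pose r : R := 2 `^ (beta + alpha' - d%:R).
  have r01 : 0 <= r < 1.
    rewrite powR_ge0 /= /r; suff h : 0 < d%:R - beta - alpha'.
      rewrite (_ : _ - _ = - (d%:R - beta - alpha')); last by ring.
      by rewrite powRN invf_lt1 ?powR_gt0// powR2_gt1.
    have : beta <= d%:R - s * p - alpha.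
      by rewrite ler_pdivrMr// ler_peMr// subr_ge0 ltW.
    have : 0 < s * p by rewrite mulr_gt0.
    lra.
  apply: (@le_lt_trans _ _ (\sum_(l <oo) (c * `|a| * C * r ^+ l)%:E)%E); last first.
    apply: le_lt_trans (nneseries_geometric_le _ r01) (ltry _).
    by rewrite !mulr_ge0// ltW.
  apply: lee_nneseries => [l _ _|l _].
    by rewrite lee_fin !mulr_ge0// invr_ge0 exprn_ge0.
  rewrite lee_fin normb.
  have -> : r ^+ l = 2 `^ (beta * l%:R) * 2 `^ (alpha' * l%:R) * 2 ^- (d * l).
    rewrite !powR2_natM -exprMn -exprVn exprM -exprMn; congr (_ ^+ l).
    rewrite /r -powRD ?pnatr_eq0 ?implybT//.
    by rewrite [LHS]powRD ?pnatr_eq0 ?implybT// powRN powR_mulrn// exprVn.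
  apply: (@le_trans _ _ (c * `|a| * 2 `^ (beta * l%:R) *
      (C * 2 `^ (alpha' * l%:R)) * 2 ^- (d * l))).
    rewrite ler_wpM2r ?invr_ge0 ?exprn_ge0// ler_wpM2l//.
    by rewrite !mulr_ge0 ?powR_ge0// ltW.
  by rewrite le_eqVlt; apply/orP; left; apply/eqP; ring.
have [f [fint C0' cE]] := synthesis mra wav phib psib cpsi pintE i1 uS sumb.
have PjE j x := Pj_finite j x uS C0' cE.
have norm_le1 : (besov_norm s p phi psi f <= 1)%E.
  rewrite /besov_norm (_ : Ccoef phi f = fun=> 0); last exact/funext.
  rewrite lp_norm0// add0e.
  apply: (@le_trans _ _ (\sum_(l <oo) ((1 - q) * q ^+ l)%:E)%E).
    apply: lee_nneseries => [l _ _|l _].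
      by rewrite (eps_j_finite s p1 (uS l) (fun i k => cE i l k)) lee_fin !mulr_ge0 ?powR_ge0.
    rewrite (eps_j_finite s p1 (uS l) (fun i k => cE i l k)) lee_fin normb.
    apply: (@le_trans _ _ (2 `^ ((s - d%:R / p) * l%:R) *
        ((C * 2 `^ (alpha' * l%:R)) `^ p^-1 * (c * `|a| * 2 `^ (beta * l%:R))))).
      rewrite ler_pM2l ?powR_gt0// ler_wpM2r//.
        by rewrite !mulr_ge0 ?powR_ge0// ltW.
      apply: ge0_ler_powR; rewrite ?nnegrE ?szS//; first by rewrite invr_ge0 ltW.
      by rewrite mulr_ge0 ?powR_ge0// ltW.
    rewrite powRM ?powR_ge0 ?(ltW C0)// -powRrM.
    rewrite cA.
    have -> : q ^+ l = 2 `^ ((s - d%:R / p) * l%:R) * 2 `^ (alpha' * l%:R * p^-1) *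
        2 `^ (beta * l%:R).
      rewrite -!powRD ?pnatr_eq0 ?implybT// -powR2_natM; congr (2 `^ _).
      by rewrite /beta; field; rewrite gt_eqF.
    by rewrite le_eqVlt; apply/orP; left; apply/eqP; rewrite /A; ring.
  apply: (le_trans (nneseries_geometric_le _ q01)).
    by rewrite subr_ge0 ltW//; case/andP: q01.
  by rewrite mulfV// subr_eq0 eq_sym lt_eqF//; case/andP: q01.
have termE l k x : rc (b l) * psi i1 (diln l k x) =
    rc (c * 2 `^ (beta * l%:R)) * (rc a * psi i1 (diln l k x)).
  rewrite /b mulrA; congr (_ * _); apply: complex_ext => /=; ring.
have w0 l : 0 < c * 2 `^ (beta * l%:R) by rewrite mulr_gt0// powR_gt0.
have rcw0 l : 0 <= rc (c * 2 `^ (beta * l%:R)) by rewrite ler0c ltW.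
have term_ge0 l k x : K x -> k \in S l -> 0 <= rc (b l) * psi i1 (diln l k x).
  by move=> Kx kS; rewrite termE mulr_ge0// Kge.
exists f; split; [|split; [by []|split]].
- by split => //; apply: le_lt_trans norm_le1 (ltry _).
- move=> x j Kx; rewrite PjE; apply: sumr_ge0 => l _.
  by rewrite big_seq_cond; apply: sumr_ge0 => k /andP[kS _]; exact: term_ge0.
- move=> x Gx; apply: (@log_growth_liminf _ _ c beta N n0) => // j n n0n nj.
  have [k kS k1] := Gge n x n0n Gx.
  have sum_ge l : 0 <= \sum_(k <- S l) rc (b l) * psi i1 (diln l k x).
    by rewrite big_seq_cond; apply: sumr_ge0 => k' /andP[kS' _]; apply: term_ge0 => //; exact: GK.
  have : rc (c * 2 `^ (beta * (N * n)%:R)) <= Pj phi psi f j x.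
    (* One term of level [N n] is isolated; all the others are nonnegative at a point of [K] and are
       dropped. *)
    rewrite PjE (bigD1 (Ordinal nj))//= (big_rem k)//= termE -addrA.
    apply: (@le_trans _ _ (rc (c * 2 `^ (beta * (N * n)%:R)) * (rc a * psi i1 (diln (N * n) k x)))).
      by rewrite ler_peMr.
    rewrite lerDl addr_ge0//; last by apply: sumr_ge0 => l _; exact: sum_ge.
    rewrite big_seq_cond; apply: sumr_ge0 => k' /andP[/mem_rem kS' _].
    by apply: term_ge0 => //; exact: GK.
  (* The order on complex numbers compares real parts, and the real part is at most the modulus. *)
  rewrite lecE => /andP[_ /= h]; apply: (le_trans h).
  exact: le_trans (ler_norm _) (normr_Re_le _).
Qed.
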